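(* Let $v>1$ be an integer such that every component $q$ of $v$ satisfies $q\equiv19\pmod{36}$. Then there exists an S$(2,\{3,6\},3v)$ which is harmonious under $\mathbb Z_3\times\mathbb F_v$.
   Context: The components of an integer $v$ are the maximal prime power divisors of $v$; $\mathbb F_v$ denotes the ring which is the direct product of the finite fields whose orders are the components of $v$ (its additive group is used). A linear space S$(2,K,v)$: $v$ points, blocks with sizes in $K$ (every element of $K$ occurring), every pair of points in exactly one block; a resolution partitions the blocks into parallel classes each partitioning the points. A linear space is harmonious under an additive group $\Gamma$ if it has point set $\Gamma$ and a resolution such that the group of translations of $\Gamma$ is an automorphism group of the resolved linear space acting sharply transitively on points and transitively on parallel classes. *)

(* Defs.v *)
From HB Require Import structures.
From mathcomp Require Import all_boot all_order all_algebra all_fingroup all_solvable all_field.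
Set Implicit Arguments.
Unset Strict Implicit.
Unset Printing Implicit Defensive.
Import GRing.Theory.

Definition prime_power (q : nat) : Prop :=
  exists p k : nat, [/\ prime p, 0 < k & q = p ^ k].

Definition components (v : nat) : seq nat := [seq v`_p | p : nat <- primes v].

Lemma componentsP (v q : nat) : 0 < v ->
  q \in components v <->
  [/\ prime_power q, q %| v &
      forall r, prime_power r -> r %| v -> q %| r -> r = q].
Proof.
move=> v_gt0; split.
  case/mapP=> p pv ->; have := pv; rewrite mem_primes => /and3P[p_pr _ p_dv].
  split; [|exact: dvdn_part|].
    by exists p, (logn p v); rewrite logn_gt0 pv p_part.
  move=> _ [l [k [l_pr k_gt0 ->]]] lk_dv vp_dv.
  have pl : p = l.
    have: p %| l ^ k.
      by apply: dvdn_trans vp_dv; rewrite p_part dvdn_exp // logn_gt0.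
    by rewrite Euclid_dvdX // => /andP[/(prime_nt_dvdP l_pr)]; rewrite gtn_eqF ?prime_gt1 // => /(_ isT) ->.
  subst l; apply/eqP; rewrite eqn_dvd vp_dv andbT p_part.
  by rewrite dvdn_exp2l // -pfactor_dvdn.
case=> -[p [k [p_pr k_gt0 ->]]] pk_dv pk_max.
have pv : p \in primes v.
  by rewrite mem_primes p_pr v_gt0 (dvdn_trans _ pk_dv) // dvdn_exp.
apply/mapP; exists p => //; symmetry; apply: pk_max; last 2 first.
- exact: dvdn_part.
- by rewrite p_part dvdn_exp2l // -pfactor_dvdn.
by exists p, (logn p v); rewrite logn_gt0 pv p_part.
Qed.

Lemma component_field_exists (v : nat) (q : seq_sub (components v)) :
  {F : finFieldType | #|F| = ssval q}.
Proof.
have /sig2_eqW[p pv Dq] : exists2 p : nat, p \in primes v & ssval q = v`_p.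
  by apply/mapP; exact: ssvalP.
have pr_p : prime p by move: pv; rewrite mem_primes => /andP[].
have k_gt0 : 0 < logn p v by rewrite logn_gt0.
have [F _ oF] := pPrimePowerField pr_p k_gt0.
by exists F; rewrite oF Dq p_part.
Qed.

Definition component_field (v : nat) (q : seq_sub (components v)) :
  finFieldType := sval (component_field_exists q).

Lemma card_component_field (v : nat) (q : seq_sub (components v)) :
  #|component_field q| = ssval q.
Proof. exact: svalP (component_field_exists q). Qed.

(* MathComp has ring structures on {ffun I -> R}, but none on dependent products. *)
Definition prod_ring (I : finType) (F : I -> finFieldType) : Type :=
  {dffun forall i : I, F i}.

Section ProdRing.
Variables (I : finType) (F : I -> finFieldType).
Local Notation P := (prod_ring F).
Local Open Scope ring_scope.

HB.instance Definition _ := Finite.copy P {dffun forall i : I, F i}.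

Definition prod0 : P := [ffun i : I => 0 : F i].
Definition prod1 : P := [ffun i : I => 1 : F i].
Definition prodN (x : P) : P := [ffun i : I => - x i].
Definition prodD (x y : P) : P := [ffun i : I => x i + y i].
Definition prodM (x y : P) : P := [ffun i : I => x i * y i].

Fact prodDA : associative prodD.
Proof. by move=> x y z; apply/ffunP=> i; rewrite !ffunE addrA. Qed.
Fact prodDC : commutative prodD.
Proof. by move=> x y; apply/ffunP=> i; rewrite !ffunE addrC. Qed.
Fact prod0D : left_id prod0 prodD.
Proof. by move=> x; apply/ffunP=> i; rewrite !ffunE add0r. Qed.
Fact prodND : left_inverse prod0 prodN prodD.
Proof. by move=> x; apply/ffunP=> i; rewrite !ffunE addNr. Qed.

HB.instance Definition _ := GRing.isZmodule.Build P prodDA prodDC prod0D prodND.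

Fact prodMA : associative prodM.
Proof. by move=> x y z; apply/ffunP=> i; rewrite !ffunE mulrA. Qed.
Fact prodMC : commutative prodM.
Proof. by move=> x y; apply/ffunP=> i; rewrite !ffunE mulrC. Qed.
Fact prod1M : left_id prod1 prodM.
Proof. by move=> x; apply/ffunP=> i; rewrite !ffunE mul1r. Qed.
Fact prodMD : left_distributive prodM prodD.
Proof. by move=> x y z; apply/ffunP=> i; rewrite !ffunE mulrDl. Qed.

HB.instance Definition _ :=
  GRing.Zmodule_isComPzRing.Build P prodMA prodMC prod1M prodMD.

End ProdRing.

HB.instance Definition _ (U V : finZmodType) := GRing.Zmodule.on (U * V)%type.

Definition FF (v : nat) := prod_ring (@component_field v).

Section LinearSpaces.
Variable T : finType.
Implicit Types (B : {set {set T}}) (R : {set {set {set T}}}).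

(* The S(2, K, n) on the point set T. *)
Definition linear_space (K : seq nat) (n : nat) B : Prop :=
  [/\ #|T| = n,
      forall b, b \in B -> #|b| \in K,
      forall k, k \in K -> exists2 b, b \in B & #|b| = k
    & forall x y, x != y -> exists! b, [/\ b \in B, x \in b & y \in b]].

Definition resolution B R : Prop :=
  partition R B /\ forall C, C \in R -> partition C [set: T].

(* 'P^* and 'P^*^* are the induced actions of a permutation s on blocks,
   b |-> s @: b, and on classes of blocks, C |-> [set s @: b | b in C]. *)
Definition resolved_automorphism_group B R (H : {group {perm T}}) : Prop :=
  [acts H, on B | 'P^*] /\ [acts H, on R | 'P^*^*].

Definition sharply_transitive (H : {group {perm T}}) : Prop :=
  forall x y : T, exists! s, s \in H /\ s x = y.

End LinearSpaces.

Section Translations.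
Variable G : finZmodType.
Local Open Scope ring_scope.

Definition translation (g : G) : {perm G} := perm (@addIr G g).

Definition translations : {set {perm G}} := [set translation g | g : G].

Fact translations_group_set : group_set translations.
Proof.
apply/group_setP; split.
  by apply/imsetP; exists 0 => //; apply/permP=> x; rewrite perm1 permE addr0.
move=> _ _ /imsetP[g _ ->] /imsetP[h _ ->]; apply/imsetP; exists (g + h) => //.
by apply/permP=> x; rewrite permM !permE addrA.
Qed.

Canonical translation_group := Group translations_group_set.

Definition harmonious (B : {set {set G}}) : Prop :=
  exists R : {set {set {set G}}},
    [/\ resolution B R,
        resolved_automorphism_group B R translation_group,
        sharply_transitive translation_group
      & [transitive translation_group, on R | 'P^*^*]].

End Translations.

(* Main.v *)
Require Import Defs.
From Stdlib Require Import BinNat.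
From Stdlib Require Nnat.
From mathcomp Require Import all_boot all_order all_algebra all_fingroup all_solvable all_field.
From mathcomp Require Import ring zify.
Set Implicit Arguments.
Unset Strict Implicit.
Unset Printing Implicit Defensive.
Import Order.TTheory GRing.Theory Num.Theory.

(** Write each component of v as q = 6k+1 and split the nonzero elements of
    F_q into the six classes of the map x -> x^k; here -1 is in class -1 and
    the cube roots of unity 1, e, e^2 are in class 1, because k is odd and
    divisible by 3.  Take the blocks A = {(0,e^i)} u {(1,e^i t)},
    D = {(0,-z e^i)} and B = {(0,-1), (1,y), (2,z)}, scaled by all elements of
    class 1.  If both {1, t, -z, -1, y, z} and
    {t-1, et-1, e^2 t-1, y+1, z-y, -1-z} meet all six classes, then the
    differences of the scaled blocks cover each element outside Z_3 x {0}
    once, and the second coordinates of their points partition the nonzero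
    elements.
    Together with Z_3 x {0} the scaled blocks and their Z_3-translates are a
    parallel class whose translates form the resolution.  This passes to
    products of fields, the class of an element being that of its first
    nonzero coordinate.

    A suitable t exists by a union bound.  For k >= 4000 suitable y and z
    exist because the classes behave pseudo-randomly: a second moment
    computation bounds the discrepancy of the number of pairs with a
    difference in a given class.  The remaining fields are settled by explicit
    parameters. *)

Local Open Scope ring_scope.
Local Delimit Scope N_scope with bin.

(** * Resolvable relative difference families *)

Section RelativeDifferenceFamily.
Variables (G : finZmodType) (H : {set G}) (D : {set {set G}}).

(** [H] is a subgroup. The [D_] hypotheses make [D] a difference family relative to [H] with index
    one; the [P_] hypotheses say that the points of its blocks represent each nontrivial coset of
    [H] once, which is what yields a parallel class. *)
Hypothesis H0 : 0 \in H.
Hypothesis HB : forall x y, x \in H -> y \in H -> x - y \in H.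
Hypothesis D_ex : forall d, d \notin H ->
  exists b u w, [/\ b \in D, u \in b, w \in b & u - w = d].
Hypothesis D_uniq : forall b b' u w u' w', b \in D -> b' \in D ->
  u \in b -> w \in b -> u' \in b' -> w' \in b' -> u != w ->
  u - w = u' - w' -> b = b' /\ u = u'.
Hypothesis D_H : forall b u w, b \in D -> u \in b -> w \in b ->
  u - w \in H -> u = w.
Hypothesis P_ex : forall g, g \notin H ->
  exists b u, [/\ b \in D, u \in b & g - u \in H].
Hypothesis P_uniq : forall b b' u u', b \in D -> b' \in D ->
  u \in b -> u' \in b' -> u - u' \in H -> b = b' /\ u = u'.
Hypothesis P_H : forall b u, b \in D -> u \in b -> u \notin H.
Hypothesis D_gt1 : forall b, b \in D -> (1 < #|b|)%N.

Definition shift (b : {set G}) (g : G) : {set G} := translation g @: b.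

Definition translates : {set {set G}} :=
  [set shift b g | b in H |: D, g in [set: G]].

(** Translating by [H] alone spreads each point of a block of [D] over its coset. *)
Definition base_class : {set {set G}} :=
  [set shift b g | b in H |: D, g in H].

Lemma mem_shift b g x : (x \in shift b g) = (x - g \in b).
Proof.
apply/imsetP/idP=> [[y yb ->]|xb]; first by rewrite permE addrK.
by exists (x - g) => //; rewrite permE subrK.
Qed.

Lemma shiftD b g g' : shift (shift b g) g' = shift b (g + g').
Proof. by apply/setP=> x; rewrite !mem_shift opprD addrA addrAC. Qed.

Lemma shift0 b : shift b 0 = b.
Proof. by apply/setP=> x; rewrite mem_shift subr0. Qed.

Lemma card_shift b g : #|shift b g| = #|b|.
Proof. by rewrite card_imset //; apply: perm_inj. Qed.

Lemma HN x : x \in H -> - x \in H.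
Proof. by move=> xH; rewrite -sub0r HB. Qed.

Lemma HD x y : x \in H -> y \in H -> x + y \in H.
Proof. by move=> xH yH; rewrite -[y]opprK HB ?HN. Qed.

Lemma shiftH g g' : g - g' \in H -> shift H g = shift H g'.
Proof.
move=> gH; apply/setP=> x; rewrite !mem_shift; apply/idP/idP=> xH.
  have -> : x - g' = (x - g) + (g - g') by rewrite addrA subrK.
  exact: HD.
have -> : x - g = (x - g') - (g - g') by rewrite opprB addrA subrK.
exact: HB.
Qed.

(** If x - y is in [H], the only block through both is their coset of [H]. Otherwise x - y is a
    difference of exactly one block of [D], and the shift is then forced. *)
Lemma translates_pair x y : x != y ->
  exists! b, [/\ b \in translates, x \in b & y \in b].
Proof.
move=> neq_xy; have [xyH|xyH] := boolP (x - y \in H).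
  exists (shift H y); split.
    split; [|by rewrite mem_shift|by rewrite mem_shift subrr].
    by apply/imset2P; exists H y; rewrite ?inE ?eqxx.
  move=> _ [/imset2P[b g bHD _ ->]]; rewrite !mem_shift => xb yb.
  move: bHD; rewrite !inE => /predU1P[Eb|bD].
    by rewrite Eb in xb yb *; apply: shiftH.
  have xyE : (x - g) - (y - g) = x - y by rewrite opprB addrA subrK.
  have := D_H bD xb yb; rewrite xyE => /(_ xyH) /addIr Exy.
  by rewrite Exy eqxx in neq_xy.
have [b [u [w [bD ub wb uwE]]]] := D_ex xyH.
exists (shift b (x - u)); split.
  split; last 2 first.
  - by rewrite mem_shift subKr.
  - rewrite mem_shift; have -> : y - (x - u) = w by
      by rewrite opprB addrCA -[y - x]opprB -uwE subKr.
    by [].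
  by apply/imset2P; exists b (x - u); rewrite ?inE ?bD ?orbT.
move=> _ [/imset2P[b' g bHD _ ->]]; rewrite !mem_shift => xb yb.
have xyE : (x - g) - (y - g) = x - y by rewrite opprB addrA subrK.
move: bHD; rewrite !inE => /predU1P[Eb|b'D].
  by rewrite Eb in xb yb; rewrite -xyE HB in xyH.
have neq_uw : u != w by rewrite -subr_eq0 uwE subr_eq0.
have [-> ->] := D_uniq bD b'D ub wb xb yb neq_uw (etrans uwE (esym xyE)).
by rewrite subKr.
Qed.

Definition class_shift (C : {set {set G}}) g := [set shift b g | b in C].

Definition classes_of_translates := [set class_shift base_class g | g : G].

Lemma shiftE b g : ('P^*)%act b (translation g) = shift b g.
Proof. by []. Qed.

(** Seen as a single orbit, the classes are permuted transitively by the translations. *)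
Lemma classes_orbit :
  classes_of_translates = orbit ('P^*^*)%act (translation_group G) base_class.
Proof.
apply/setP=> C; apply/imsetP/imsetP=> [[g _ ->]|[_ /imsetP[g _ ->] ->]].
  by exists (translation g) => //; apply/imsetP; exists g.
by exists g.
Qed.

Lemma class_shift_cover g x : exists2 b, b \in class_shift base_class g & x \in b.
Proof.
suff [b bH xb]: exists2 b, b \in base_class & x - g \in b.
  by exists (shift b g); [apply: imset_f | rewrite mem_shift].
have [xH|xH] := boolP (x - g \in H).
  exists (shift H 0); last by rewrite shift0.
  by apply/imset2P; exists H 0; rewrite ?setU11.
have [b [u [bD ub guH]]] := P_ex xH; exists (shift b (x - g - u)).
  by apply/imset2P; exists b (x - g - u); rewrite ?inE ?bD ?orbT.
by rewrite mem_shift subKr.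
Qed.

(** Blocks sharing [x] come from points congruent modulo [H]. Two such points of [D] coincide by
    [P_uniq], and [P_H] keeps the points of [D] away from [H] itself. *)
Lemma base_class_triv b b' x : b \in base_class -> b' \in base_class ->
  x \in b -> x \in b' -> b = b'.
Proof.
case/imset2P=> c h cHD hH -> /imset2P[c' h' cHD' hH' ->].
rewrite !mem_shift; have xx : (x - h) - (x - h') \in H.
  by rewrite opprB addrC addrA subrK HB.
move: cHD cHD'; rewrite !inE => /predU1P[->|cD] /predU1P[->|cD'] xc xc'.
- by apply: shiftH; rewrite HB.
- have /negP[] := P_H cD' xc'; have -> : x - h' = (x - h) - (x - h - (x - h')).
    by rewrite subKr.
  exact: HB.
- have /negP[] := P_H cD xc; have -> : x - h = (x - h - (x - h')) + (x - h').
    by rewrite subrK.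
  exact: HD.
by have [-> /addrI/oppr_inj->] := P_uniq cD cD' xc xc' xx.
Qed.

Lemma translates_neq0 b : b \in translates -> b != set0.
Proof.
case/imset2P=> c g; rewrite !inE -card_gt0 => /predU1P[->|cD] _ ->.
  by rewrite card_shift; apply/card_gt0P; exists 0.
by rewrite card_shift (ltn_trans _ (D_gt1 cD)).
Qed.

Lemma class_sub_translates g b : b \in class_shift base_class g -> b \in translates.
Proof.
case/imsetP=> _ /imset2P[c h cHD hH ->] ->; rewrite shiftD.
by apply/imset2P; exists c (h + g); rewrite ?inE // -in_setU1.
Qed.

Lemma class_partition g : partition (class_shift base_class g) [set: G].
Proof.
apply/and3P; split.
- apply/eqP/setP=> x; rewrite inE; apply/bigcupP.
  by have [b] := class_shift_cover g x; exists b.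
- apply/trivIsetP=> _ _ /imsetP[b bB ->] /imsetP[b' bB' ->] neq.
  rewrite -setI_eq0; apply/eqP/setP=> x; rewrite !inE !mem_shift.
  apply/negP=> /andP[xb xb']; case/eqP: neq.
  by rewrite (base_class_triv bB bB' xb xb').
by apply/negP=> /class_sub_translates/translates_neq0; rewrite eqxx.
Qed.

(** [H] stabilises the base class, so its translates depend only on cosets of [H]. *)
Lemma base_class_shiftH g : g \in H -> class_shift base_class g = base_class.
Proof.
move=> gH; apply/setP=> b; apply/imsetP/imset2P.
  case=> _ /imset2P[c h cHD hH ->] ->; rewrite shiftD.
  by exists c (h + g) => //; apply: HD.
case=> c h cHD hH ->; exists (shift c (h - g)); last by rewrite shiftD subrK.
by apply/imset2P; exists c (h - g) => //; apply: HB.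
Qed.

Lemma class_shiftD C g g' : class_shift (class_shift C g) g' = class_shift C (g + g').
Proof.
apply/setP=> b; apply/imsetP/imsetP.
  by case=> _ /imsetP[c cC ->] ->; exists c => //; rewrite shiftD.
by case=> c cC ->; exists (shift c g); [apply: imset_f | rewrite shiftD].
Qed.

Lemma class_shift_eq g g' : g - g' \in H ->
  class_shift base_class g = class_shift base_class g'.
Proof. by move=> ggH; rewrite -[g](subrK g') -class_shiftD base_class_shiftH. Qed.

(** This makes distinct classes disjoint. A block of [D] has a difference outside [H], so it is no
    translate of [H]; two translates of blocks of [D] are compared through the uniqueness of
    differences. *)
Lemma shift_base_eq c c' g g' : c \in H |: D -> c' \in H |: D ->
  shift c g = shift c' g' -> g - g' \in H.
Proof.
have shiftHD c1 g1 g2 : c1 \in D -> shift H g1 <> shift c1 g2.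
  move=> cD1 /setP E; have /card_gt1P[u [w [uc wc]]] := D_gt1 cD1.
  have := E (u + g2); have := E (w + g2); rewrite !mem_shift !addrK uc wc => wH uH.
  suff: u - w \in H by move/(D_H cD1 uc wc)=> ->; rewrite eqxx.
  have -> : u - w = (u + g2 - g1) - (w + g2 - g1).
    by rewrite opprB addrA subrK opprD addrACA subrr addr0.
  exact: HB.
rewrite !inE => /predU1P[->|cD] /predU1P[->|cD'].
- move/setP/(_ g); rewrite !mem_shift subrr H0 => /esym; exact.
- by move/(shiftHD _ _ _ cD').
- by move/esym/(shiftHD _ _ _ cD).
move/setP=> E; have /card_gt1P[u [w [uc wc neq]]] := D_gt1 cD.
have := E (u + g); have := E (w + g); rewrite !mem_shift !addrK uc wc.
move=> /esym wH /esym uH.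
(* The points [u], [w] of [c] and their images under the shift g - g' in [c'] have the same
   difference, so [u] equals its image and g = g'. *)
have [|_] := D_uniq cD cD' uc wc uH wH neq.
  by rewrite opprB addrA subrK opprD addrACA subrr addr0.
by move/eqP; rewrite -addrA -{1}[u]addr0 (inj_eq (addrI u)) => /eqP <-.
Qed.

Theorem difference_family_harmonious : harmonious translates.
Proof.
exists classes_of_translates; split.
- split; last by move=> _ /imsetP[g _ ->]; apply: class_partition.
  apply/and3P; split.
  + apply/eqP/setP=> b; apply/bigcupP/idP=> [[_ /imsetP[g _ ->]]|].
      exact: class_sub_translates.
    case/imset2P=> c g cHD _ ->; exists (class_shift base_class g).
      exact: imset_f.
    by apply: imset_f; apply/imset2P; exists c 0; rewrite ?shift0.
  + apply/trivIsetP=> _ _ /imsetP[g _ ->] /imsetP[g' _ ->] neq.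
    rewrite -setI_eq0; apply/eqP/setP=> b; rewrite !inE.
    apply/negP=> /andP[/imsetP[_ /imset2P[c h cHD hH ->] ->]].
    case/imsetP=> _ /imset2P[c' h' cHD' hH' ->]; rewrite !shiftD => E.
    case/eqP: neq; apply: class_shift_eq.
    have -> : g - g' = (h + g - (h' + g')) - (h - h').
      by rewrite [- (h' + g')]opprD addrACA [h - h' + _]addrC addrK.
    by apply: HB (HB hH hH'); apply: shift_base_eq E.
  + apply/negP=> /imsetP[g _] /esym E0.
    by have [b] := class_shift_cover g 0; rewrite E0 inE.
- split.
    apply/subsetP=> _ /imsetP[g _ ->]; rewrite inE /=.
    apply/andP; split; first by rewrite inE.
    rewrite inE; apply/subsetP=> b /imset2P[c h cHD _ ->].
    rewrite inE shiftE shiftD; apply/imset2P; exists c (h + g) => //.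
  rewrite classes_orbit; apply: acts_orbit; exact: subsetT.
- move=> x y; exists (translation (y - x)); split.
    by rewrite permE addrCA subrr addr0; split=> //; apply/imsetP; exists (y - x).
  by move=> _ [/imsetP[g _ ->]]; rewrite permE => <-; rewrite [x + g]addrC addrK.
- by rewrite classes_orbit; apply/imsetP; exists base_class => //; apply: orbit_refl.
Qed.

End RelativeDifferenceFamily.

Definition class_exp (F : finFieldType) : nat := (#|F|.-1 %/ 6)%N.

(* The first list holds the second coordinates of the blocks up to powers of e,
   the second one the differences whose Z_3-coordinate is 1. *)
Definition starter (F : finFieldType) (e t y z : F) : Prop :=
  [/\ e * e + e + 1 = 0,
      uniq (0 :: [seq x ^+ class_exp F | x <- [:: 1; t; - z; -1; y; z]])
    & uniq (0 :: [seq x ^+ class_exp F |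
        x <- [:: t - 1; e * t - 1; e * e * t - 1; y + 1; z - y; -1 - z]])].

(** * Power classes in a field and in a product of fields *)

Lemma map_uniq_inj (T1 T2 : eqType) (g : T1 -> T2) (s : seq T1) :
  uniq (map g s) -> {in s &, injective g}.
Proof.
elim: s => // a s IHs /= /andP[gas us] x y; rewrite !inE.
case/predU1P=> [->|xs] /predU1P[->|ys] // E.
- by rewrite E map_f in gas.
- by rewrite -E map_f in gas.
exact: IHs.
Qed.

Section OrderMod36.
Variable F : finFieldType.
Hypothesis F_mod : (#|F| = 19 %[mod 36])%N.

(** Oddness of the exponent gives [class_expN]; divisibility by 3 gives [class_exp_omega]. *)
Lemma class_expE : exists m, class_exp F = (6 * m + 3)%N.
Proof.
exists (#|F| %/ 36)%N; rewrite /class_exp {1}(divn_eq #|F| 36) F_mod; lia.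
Qed.

Lemma class_exp_gt0 : (0 < class_exp F)%N.
Proof. by have [m ->] := class_expE; rewrite addn3. Qed.

Lemma card_class_exp : #|F| = (6 * class_exp F).+1.
Proof.
by rewrite /class_exp {2}(divn_eq #|F| 36) [LHS](divn_eq #|F| 36) F_mod; lia.
Qed.

Lemma expr_class_exp6 (x : F) : x != 0 -> (x ^+ class_exp F) ^+ 6 = 1.
Proof.
move=> x0; rewrite -exprM mulnC.
by apply: (mulfI x0); rewrite -exprS -card_class_exp expf_card mulr1.
Qed.

Lemma class_expN (x : F) : (- x) ^+ class_exp F = - x ^+ class_exp F.
Proof. by rewrite exprNn -signr_odd; have [m ->] := class_expE; rewrite oddD oddM expr1 mulN1r. Qed.

Lemma class_exp_omega (e : F) : e * e + e + 1 = 0 -> e ^+ class_exp F = 1.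
Proof.
move=> e0; have [m ->] := class_expE.
have -> : (6 * m + 3 = 3 * (2 * m + 1))%N by rewrite mulnDr mulnA.
have e3 : e ^+ 3 - 1 = (e - 1) * (e * e + e + 1) by ring.
move/eqP: e3; rewrite e0 mulr0 subr_eq0 => /eqP e3.
by rewrite exprM e3 expr1n.
Qed.

Lemma class_exp_eq0 (x : F) : (x ^+ class_exp F == 0) = (x == 0).
Proof. by rewrite expf_eq0 class_exp_gt0. Qed.

(** X^6 - 1 has at most six roots, so six distinct ones are all of them. Hence meeting all six
    classes can be stated as six class values being distinct and nonzero. *)
Lemma mem_sixth_roots (s : seq F) c : size s = 6%N -> uniq (0 :: s) ->
  (forall x, x \in s -> x ^+ 6 = 1) -> c ^+ 6 = 1 -> c \in s.
Proof.
move=> ss /= /andP[_ us] s6 c6; apply/negPn/negP=> cs.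
have: (size (c :: s) < size ('X^6 - 1%:P : {poly F})%R)%N.
  apply: max_poly_roots; first by rewrite -size_poly_eq0 size_XnsubC.
    apply/allP=> x; rewrite inE => xs; rewrite rootE !hornerE subr_eq0.
    by move: xs => /predU1P[->|/s6->]; rewrite ?c6.
  by rewrite /= cs.
by rewrite size_XnsubC //= ss.
Qed.

End OrderMod36.

(** * Tilings of the nonzero elements of a product of fields *)

Section Tiling.
Variables (I : finType) (F : I -> finFieldType).
Local Notation P := (prod_ring F).
Hypothesis F_mod : forall i, (#|F i| = 19 %[mod 36])%N.

Definition lead (s : P) := [pick i | s i != 0].

(* Plays the role of the subgroup of sixth powers; it is not a group when there
   are several fields. *)
Definition class1 : {set P} :=
  [set s | if lead s is Some i then s i ^+ class_exp (F i) == 1 else false].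

Lemma prod_mulE (x y : P) i : (x * y) i = x i * y i.
Proof. by rewrite ffunE. Qed.
Lemma prod_addE (x y : P) i : (x + y) i = x i + y i.
Proof. by rewrite ffunE. Qed.
Lemma prod_oppE (x : P) i : (- x) i = - x i.
Proof. by rewrite ffunE. Qed.
Lemma prod_0E i : (0 : P) i = 0.
Proof. by rewrite ffunE. Qed.
Lemma prod_1E i : (1 : P) i = 1.
Proof. by rewrite ffunE. Qed.
Definition prodE := (prod_addE, prod_mulE, prod_oppE, prod_0E, prod_1E).

Lemma lead_mul (s d : P) : (forall i, d i != 0) -> lead (s * d) = lead s.
Proof.
by move=> d0; apply: eq_pick => i /=; rewrite prodE mulf_eq0 (negPf (d0 i)) orbF.
Qed.

Section Family.
Variables (X : eqType) (ks : seq X) (f : X -> P).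
Hypothesis ks6 : size ks = 6%N.
Hypothesis ks_uniq : forall i,
  uniq (0 :: [seq f x i ^+ class_exp (F i) | x <- ks]).

Lemma tile_neq0 x i : x \in ks -> f x i != 0.
Proof.
move=> xks; have /andP[+ _] := ks_uniq i; apply: contra => /eqP fx0.
apply/mapP; exists x => //.
by rewrite fx0 expr0n; case: class_exp (class_exp_gt0 (F_mod i)).
Qed.

(** The class of [n] at its leading coordinate selects [x]. Every coordinate of [f x] is nonzero, so
    [s] can be the coordinatewise quotient, with the same leading coordinate as [n]. *)
Lemma tile_ex n : n != 0 ->
  exists x s, [/\ x \in ks, s \in class1 & n = s * f x].
Proof.
move=> n0; have [i ni0|n_0] := pickP (fun i => n i != 0); last first.
  by case/eqP: n0; apply/ffunP=> i; have /eqP-> := negbFE (n_0 i); rewrite prodE.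
case Dl: (lead n) => [j|]; last first.
  by move: Dl; rewrite /lead; case: pickP => // /(_ i); rewrite ni0.
have nj0 : n j != 0 by move: Dl; rewrite /lead; case: pickP => // j' ? [<-].
have: n j ^+ class_exp (F j) \in [seq f x j ^+ class_exp (F j) | x <- ks].
  apply: mem_sixth_roots (ks_uniq j) _ _ => //.
  - by rewrite size_map.
  - by move=> _ /mapP[x xks ->]; rewrite expr_class_exp6 ?tile_neq0.
  by rewrite expr_class_exp6.
case/mapP=> x xks Dh; pose s : P := [ffun i => n i / f x i].
have Dn : n = s * f x.
  by apply/ffunP=> i'; rewrite prodE ffunE divfK // tile_neq0.
exists x, s; split=> //; rewrite inE.
have -> : lead s = Some j.
  by rewrite -Dl Dn lead_mul // => i'; rewrite tile_neq0.
by rewrite ffunE expr_div_n Dh divff // class_exp_eq0 ?tile_neq0.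
Qed.

Lemma class1_lead s : s \in class1 ->
  exists i, [/\ lead s = Some i, s i != 0 & s i ^+ class_exp (F i) = 1].
Proof.
rewrite inE; case Dl: (lead s) => [i|] // /eqP si; exists i; split=> //.
by move: Dl; rewrite /lead; case: pickP => // j ? [<-].
Qed.

(** Both products share a leading coordinate, where [s] and [s'] have class 1. Comparing classes
    there gives x = x', and [f x] then cancels in every coordinate. *)
Lemma tile_uniq x x' s s' : x \in ks -> x' \in ks ->
  s \in class1 -> s' \in class1 -> s * f x = s' * f x' -> x = x' /\ s = s'.
Proof.
move=> xks xks' sK sK' E.
have [i [Dl si0 si1]] := class1_lead sK; have [i' [Dl' si0' si1']] := class1_lead sK'.
have Ei : i = i'.
  apply: Some_inj; rewrite -Dl -Dl'.
  rewrite -(@lead_mul s (f x)) => [|j]; last exact: tile_neq0.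
  by rewrite E lead_mul // => j; rewrite tile_neq0.
subst i'; have /andP[_ u] := ks_uniq i.
have Exx : x = x'.
  by apply: (map_uniq_inj u) => //=; rewrite -[LHS]mul1r -[RHS]mul1r -{1}si1 -si1' -!exprMn;
    have /(congr1 (fun g : P => g i)) := E; rewrite !prodE => ->.
subst x'; split=> //; apply/ffunP=> j.
by have /(congr1 (fun g : P => g j)) := E; rewrite !prodE => /(mulIf (tile_neq0 j xks)).
Qed.

Lemma tile_mul_neq0 x s : x \in ks -> s \in class1 -> s * f x != 0.
Proof.
move=> xks /class1_lead[i [_ si0 _]]; apply/eqP=> /(congr1 (fun g : P => g i)).
by rewrite !prodE => /eqP; rewrite mulf_eq0 (negPf si0) (negPf (tile_neq0 _ _)).
Qed.

End Family.
End Tiling.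

(** * Base blocks *)

Definition tiles (R : finComPzRingType) (K : {set R}) (X : eqType)
    (ks : seq X) (f : X -> R) : Prop :=
  [/\ forall n, n != 0 -> exists x s, [/\ x \in ks, s \in K & n = s * f x],
      forall x x' s s', x \in ks -> x' \in ks -> s \in K -> s' \in K ->
        s * f x = s' * f x' -> x = x' /\ s = s'
    & forall x s, x \in ks -> s \in K -> s * f x != 0].

Section BaseBlocks.
Variables (R : finComPzRingType) (K : {set R}) (e t y z : R).
Local Notation G := ('Z_3 * R)%type.
Implicit Types (T : seq G) (s : R) (u w : G).

Definition six_block : seq G :=
  [:: (0, 1); (0, e); (0, e * e); (1, t); (1, e * t); (1, e * e * t)].
Definition flat_triple : seq G := [:: (0, - z); (0, e * - z); (0, e * e * - z)].
Definition skew_triple : seq G := [:: (0, -1); (1, y); (- 1, z)].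

(** The three lists split the pairs of points by the ['Z_3]-coordinate of their difference: 0 here,
    1 in [pairs1] and -1 in [pairs2]. Of each orbit under multiplication by [e] one pair is kept,
    the one whose second point is listed in [points]. *)
Definition pairs0 : seq (seq G * (G * G)) :=
  [:: (six_block, ((0, e), (0, 1))); (six_block, ((0, e * e), (0, 1)));
      (six_block, ((1, e * t), (1, t))); (six_block, ((1, e * e * t), (1, t)));
      (flat_triple, ((0, e * - z), (0, - z)));
      (flat_triple, ((0, e * e * - z), (0, - z)))].

Definition pairs1 : seq (seq G * (G * G)) :=
  [:: (six_block, ((1, t), (0, 1))); (six_block, ((1, e * t), (0, 1)));
      (six_block, ((1, e * e * t), (0, 1)));
      (skew_triple, ((1, y), (0, -1))); (skew_triple, ((- 1, z), (1, y)));
      (skew_triple, ((0, -1), (- 1, z)))].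

Definition pairs2 : seq (seq G * (G * G)) :=
  [:: (six_block, ((0, 1), (1, t))); (six_block, ((0, e), (1, t)));
      (six_block, ((0, e * e), (1, t)));
      (skew_triple, ((0, -1), (1, y))); (skew_triple, ((1, y), (- 1, z)));
      (skew_triple, ((- 1, z), (0, -1)))].

Definition points : seq (seq G * G) :=
  [:: (six_block, (0, 1)); (six_block, (1, t)); (flat_triple, (0, - z));
      (skew_triple, (0, -1)); (skew_triple, (1, y)); (skew_triple, (- 1, z))].

Definition pair_diff (k : seq G * (G * G)) : R := k.2.1.2 - k.2.2.2.

Hypothesis e_root : e * e + e + 1 = 0.
Hypothesis K_e : forall s, s \in K -> s * e \in K.
Hypothesis K_gt0 : exists s, s \in K.
Hypothesis tile0 : tiles K pairs0 pair_diff.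
Hypothesis tile1 : tiles K pairs1 pair_diff.
Hypothesis tile2 : tiles K pairs2 pair_diff.
Hypothesis tileP : tiles K points (fun k => k.2.2).

Definition scale s u : G := (u.1, s * u.2).
Definition scaled s T : {set G} := [set scale s u | u in T].

Definition templates := [:: six_block; flat_triple; skew_triple].

Definition base_blocks : {set {set G}} :=
  [set scaled s six_block | s in K] :|: [set scaled s flat_triple | s in K]
    :|: [set scaled s skew_triple | s in K].

Lemma mem_base_blocks b : reflect (exists T s, [/\ T \in templates, s \in K & b = scaled s T])
  (b \in base_blocks).
Proof.
apply: (iffP idP).
  by rewrite !inE => /orP[/orP[]|] /imsetP[s sK ->];
     eexists _, s; split=> //; rewrite !inE eqxx ?orbT.
case=> T [s [+ sK ->]]; rewrite !inE => /or3P[] /eqP->;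
  by rewrite imset_f ?orbT.
Qed.

Lemma omega3 : e * (e * e) = 1.
Proof.
apply/subr0_eq; have -> : e * (e * e) - 1 = (e - 1) * (e * e + e + 1) by ring.
by rewrite e_root mulr0.
Qed.

Lemma scaledP s T u : reflect (exists2 u0, u0 \in T & u = scale s u0) (u \in scaled s T).
Proof. exact: imsetP. Qed.

Lemma scaled_omega s T : T \in [:: six_block; flat_triple] ->
  scaled (s * e) T = scaled s T.
Proof.
have e3 := omega3.
have sub T' s' : T' \in [:: six_block; flat_triple] -> scaled (s' * e) T' \subset scaled s' T'.
  move=> TT; apply/subsetP=> _ /scaledP[u uT ->]; apply/scaledP; move: TT uT.
  rewrite !inE => /orP[] /eqP->; rewrite !inE.
    move=> /or4P[|||/or3P[]] /eqP->.
    - by exists (0, e); rewrite ?inE ?eqxx ?orbT // /scale; congr pair; rewrite /=; ring.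
    - by exists (0, e * e); rewrite ?inE ?eqxx ?orbT // /scale; congr pair; rewrite /=; ring.
    - by exists (0, 1); rewrite ?inE ?eqxx ?orbT // /scale; congr pair; rewrite /=; ring: e3.
    - by exists (1, e * t); rewrite ?inE ?eqxx ?orbT // /scale; congr pair; rewrite /=; ring.
    - by exists (1, e * e * t); rewrite ?inE ?eqxx ?orbT // /scale; congr pair; rewrite /=; ring.
    - by exists (1, t); rewrite ?inE ?eqxx ?orbT // /scale; congr pair; rewrite /=; ring: e3.
  move=> /or3P[] /eqP->.
  - by exists (0, e * - z); rewrite ?inE ?eqxx ?orbT // /scale; congr pair; rewrite /=; ring.
  - by exists (0, e * e * - z); rewrite ?inE ?eqxx ?orbT // /scale; congr pair; rewrite /=; ring.
  - by exists (0, - z); rewrite ?inE ?eqxx ?orbT // /scale; congr pair; rewrite /=; ring: e3.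
(* Since e^3 = 1, applying the inclusion twice more closes a cycle and gives equality. *)
move=> TT; apply/eqP; rewrite eqEsubset sub //=.
apply: subset_trans (sub _ _ TT); apply: subset_trans (sub _ _ TT).
by rewrite -!mulrA e3 mulr1.
Qed.

Definition pairs := pairs0 ++ pairs1 ++ pairs2.

(** Moving a power of [e] into the scale rotates each point of [six_block] or [flat_triple] to a
    representative without changing the scaled block. The points of [skew_triple] are all listed, so
    there the scale stays. *)
Lemma normalize_point s T w : s \in K -> T \in templates -> w \in T ->
  exists w0 s', [/\ (T, w0) \in points, s' \in K, scaled s T = scaled s' T
    & scale s w = scale s' w0].
Proof.
have rot1 s1 T1 : T1 \in [:: six_block; flat_triple] -> scaled s1 T1 = scaled (s1 * e) T1.
  by move/scaled_omega=> ->.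
have rot2 s1 T1 : T1 \in [:: six_block; flat_triple] -> scaled s1 T1 = scaled (s1 * e * e) T1.
  by move=> TT; rewrite !scaled_omega.
have sixO : six_block \in [:: six_block; flat_triple] by rewrite inE eqxx.
have flatO : flat_triple \in [:: six_block; flat_triple] by rewrite !inE eqxx orbT.
move=> sK; rewrite !inE => /or3P[] /eqP->; rewrite !inE.
- move=> /or4P[|||/or3P[]] /eqP->.
  + by exists (0, 1), s; split=> //; rewrite !inE eqxx ?orbT.
  + exists (0, 1), (s * e); split; rewrite ?K_e -?rot1 ?inE ?eqxx ?orbT // /scale.
    by congr pair => /=; ring.
  + exists (0, 1), (s * e * e); split; rewrite ?K_e -?rot2 ?inE ?eqxx ?orbT // /scale.
    by congr pair => /=; ring.
  + by exists (1, t), s; split=> //; rewrite !inE eqxx ?orbT.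
  + exists (1, t), (s * e); split; rewrite ?K_e -?rot1 ?inE ?eqxx ?orbT // /scale.
    by congr pair => /=; ring.
  + exists (1, t), (s * e * e); split; rewrite ?K_e -?rot2 ?inE ?eqxx ?orbT // /scale.
    by congr pair => /=; ring.
- move=> /or3P[] /eqP->.
  + by exists (0, - z), s; split=> //; rewrite !inE eqxx ?orbT.
  + exists (0, - z), (s * e); split; rewrite ?K_e -?rot1 ?inE ?eqxx ?orbT // /scale.
    by congr pair => /=; ring.
  + exists (0, - z), (s * e * e); split; rewrite ?K_e -?rot2 ?inE ?eqxx ?orbT // /scale.
    by congr pair => /=; ring.
move=> wB; exists w, s; split=> //.
by move: wB => /or3P[] /eqP->; rewrite !inE eqxx ?orbT.
Qed.

Lemma points_pairs T w u : (T, w) \in points -> u \in T -> u != w ->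
  (T, (u, w)) \in pairs.
Proof.
rewrite /points !in_cons in_nil orbF => /orP[|/or4P[||| /orP[]]] /eqP[-> ->];
  rewrite !in_cons in_nil orbF.
1,2: by move=> /or4P[|||/or3P[]] /eqP->; rewrite ?eqxx ?orbT.
all: by move=> /or3P[] /eqP->; rewrite ?eqxx ?orbT.
Qed.

(* Multiplying the scale by e rotates six_block and flat_triple, so every pair
   of points of a base block is one of 18 pairs up to scaling. *)
Lemma normalize_pair s T u w : s \in K -> T \in templates -> u \in T -> w \in T ->
  scale s u != scale s w -> exists k s', [/\ k \in pairs, s' \in K, scaled s T = scaled s' k.1,
    scale s u = scale s' k.2.1 & scale s w = scale s' k.2.2].
Proof.
move=> sK TT uT wT; have [w0 [s' [w0P s'K ET ->]]] := normalize_point sK TT wT.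
have: scale s u \in scaled s' T by rewrite -ET imset_f.
case/scaledP=> u0 u0T -> neq; exists (T, (u0, w0)), s'; split=> //.
by apply: points_pairs => //; apply: contraNneq neq => ->.
Qed.

Lemma pairs_layer k : k \in pairs -> 
  [\/ k \in pairs0 /\ k.2.1.1 - k.2.2.1 = 0, k \in pairs1 /\ k.2.1.1 - k.2.2.1 = 1
    | k \in pairs2 /\ k.2.1.1 - k.2.2.1 = - 1].
Proof.
have layer ks c : all (fun k : seq G * (G * G) => k.2.1.1 - k.2.2.1 == c) ks ->
  k \in ks -> k \in ks /\ k.2.1.1 - k.2.2.1 = c.
  by move=> /allP kc kks; split=> //; apply/eqP/kc.
rewrite !mem_cat => /or3P[] kk; [constructor 1|constructor 2|constructor 3];
  by apply: layer kk; rewrite /= ?subrr ?subr0 ?sub0r ?eqxx.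
Qed.

Lemma layerP (c : 'Z_3) : [\/ c = 0, c = 1 | c = - 1].
Proof.
case: c => [[|[|[|]]]] // p; [constructor 1|constructor 2|constructor 3]; exact/val_inj.
Qed.

Lemma scaleB s u w : (scale s u - scale s w) = (u.1 - w.1, s * (u.2 - w.2)).
Proof. by rewrite mulrBr. Qed.

Lemma pairs_ex (d : G) : d.2 != 0 -> exists k s,
  [/\ k \in pairs, s \in K & scale s k.2.1 - scale s k.2.2 = d].
Proof.
move=> d0.
have [ex0 _ _] := tile0; have [ex1 _ _] := tile1; have [ex2 _ _] := tile2.
have go ks c : (forall k, k \in ks -> k \in pairs /\ k.2.1.1 - k.2.2.1 = c) ->
    (exists k s, [/\ k \in ks, s \in K & d.2 = s * pair_diff k]) -> d.1 = c ->
    exists k s, [/\ k \in pairs, s \in K & scale s k.2.1 - scale s k.2.2 = d].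
  move=> ksP [k [s [kks sK dE]]] dc; have [kp kc] := ksP k kks.
  by exists k, s; split=> //; rewrite scaleB kc -dc -dE -surjective_pairing.
have layer ks c : all (fun k : seq G * (G * G) => (k.2.1.1 - k.2.2.1 == c)) ks ->
    {subset ks <= pairs} -> forall k, k \in ks -> k \in pairs /\ k.2.1.1 - k.2.2.1 = c.
  by move=> /allP kc sub k kks; split; [apply: sub | apply/eqP/kc].
case: (layerP d.1); [apply: go (ex0 _ d0)|apply: go (ex1 _ d0)|apply: go (ex2 _ d0)];
  (apply: layer; [by rewrite /= ?subrr ?subr0 ?sub0r ?eqxx |
    by move=> k; rewrite !mem_cat => ->; rewrite ?orbT]).
Qed.

(** Equal differences have the same ['Z_3]-coordinate, so both pairs belong to one list and the
    tiling of that list decides. *)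
Lemma pairs_uniq k k' s s' : k \in pairs -> k' \in pairs -> s \in K -> s' \in K ->
  scale s k.2.1 - scale s k.2.2 = scale s' k'.2.1 - scale s' k'.2.2 -> k = k' /\ s = s'.
Proof.
have [_ u0 _] := tile0; have [_ u1 _] := tile1; have [_ u2 _] := tile2.
move=> kp kp' sK sK'; rewrite !scaleB => E.
have /= E1 := congr1 fst E; have /= E2 := congr1 snd E.
by case: (pairs_layer kp) => -[kk c]; case: (pairs_layer kp') => -[kk' c'];
  move/eqP: E1; rewrite c c' // => _; [apply: u0 E2 | apply: u1 E2 | apply: u2 E2].
Qed.

Lemma pairs_neq0 k s : k \in pairs -> s \in K -> s * (k.2.1.2 - k.2.2.2) != 0.
Proof.
have [_ _ n0] := tile0; have [_ _ n1] := tile1; have [_ _ n2] := tile2.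
by move=> kp sK; case: (pairs_layer kp) => -[kk _]; [apply: n0|apply: n1|apply: n2].
Qed.

Definition axis : {set G} := [set g | g.2 == 0].

(** A scale may be a zero divisor, so it cannot be cancelled; scaled points are distinct because the
    tilings exclude zero products. *)
Lemma card_scaled s T : s \in K -> T \in templates -> #|scaled s T| = size T.
Proof.
move=> sK TT; have -> : #|scaled s T| = #|[seq scale s u | u <- T]|.
  by apply: eq_card => u; apply/scaledP/mapP.
rewrite -(size_map (scale s)); apply/card_uniqP.
have neq s1 k : s1 \in K -> k \in pairs -> s1 * k.2.1.2 != s1 * k.2.2.2.
  by move=> s1K kp; rewrite -subr_eq0 -mulrBr; exact: pairs_neq0 kp s1K.
(* The third inequality, between s e m1 and s e^2 m1, is the first one at scale s e. *)
have orbit_uniq T1 (c : 'Z_3) m1 m2 m3 : (T1, ((c, m2), (c, m1))) \in pairs ->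
    (T1, ((c, m3), (c, m1))) \in pairs -> m2 = e * m1 -> m3 = e * e * m1 ->
  uniq [:: (c, s * m1); (c, s * m2); (c, s * m3)].
  move=> k2 k3 E2 E3; have := neq _ _ (K_e sK) k2.
  have := neq _ _ sK k3; have := neq _ _ sK k2; rewrite /= E2 E3 -!mulrA => n1 n2 n3.
  rewrite /= !in_cons !in_nil !xpair_eqE !eqxx /= !orbF negb_or.
  rewrite [s * m1 == s * (e * m1)]eq_sym [s * m1 == _]eq_sym.
  by rewrite [s * (e * m1) == s * (e * (e * m1))]eq_sym n1 n2 n3.
have mem k : (k \in pairs0) || (k \in pairs1) || (k \in pairs2) -> k \in pairs.
  by rewrite !mem_cat -orbA.
move: TT; rewrite !inE => /or3P[] /eqP->.
- have -> : map (scale s) six_block = [:: (0, s * 1); (0, s * e); (0, s * (e * e))]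
    ++ [:: (1, s * t); (1, s * (e * t)); (1, s * (e * e * t))] by [].
  rewrite cat_uniq; apply/and3P; split.
  + apply: (@orbit_uniq six_block); rewrite ?mulr1 //; apply: mem;
    by rewrite /pairs0 !in_cons eqxx ?orbT.
  + by apply/hasPn=> u; rewrite !in_cons !in_nil => /or4P[] // /eqP->; rewrite !xpair_eqE.
  + apply: (@orbit_uniq six_block) => //; apply: mem;
    by rewrite /pairs0 !in_cons eqxx ?orbT.
- apply: (@orbit_uniq flat_triple) => //; apply: mem;
  by rewrite /pairs0 !in_cons eqxx ?orbT.
by rewrite /skew_triple !map_cons cons_uniq !in_cons !xpair_eqE /=.
Qed.

Definition harmonious_blocks := translates axis base_blocks.

Lemma base_blocks_ex d : d \notin axis ->
  exists b u w, [/\ b \in base_blocks, u \in b, w \in b & u - w = d].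
Proof.
rewrite inE => /pairs_ex[k [s [kp sK <-]]].
exists (scaled s k.1), (scale s k.2.1), (scale s k.2.2).
have : [&& k.1 \in templates, k.2.1 \in k.1 & k.2.2 \in k.1].
  move: k kp; apply/allP.
  by rewrite /= !in_cons !eqxx !orbT.
case/and3P=> kT uk wk; split=> //; rewrite ?imset_f //.
by apply/mem_base_blocks; exists k.1, s.
Qed.

Lemma base_blocks_uniq b b' u w u' w' : b \in base_blocks -> b' \in base_blocks ->
  u \in b -> w \in b -> u' \in b' -> w' \in b' -> u != w ->
  u - w = u' - w' -> b = b' /\ u = u'.
Proof.
move=> /mem_base_blocks[T [s [TT sK ->]]] /mem_base_blocks[T' [s' [TT' sK' ->]]].
move=> /scaledP[u0 uT ->] /scaledP[w0 wT ->] /scaledP[u0' uT' ->] /scaledP[w0' wT' ->].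
move=> neq E; have neq' : scale s' u0' != scale s' w0' by rewrite -subr_eq0 -E subr_eq0.
have [k [s1 [kp s1K -> Eu Ew]]] := normalize_pair sK TT uT wT neq.
have [k' [s1' [kp' s1K' -> Eu' Ew']]] := normalize_pair sK' TT' uT' wT' neq'.
rewrite Eu Ew Eu' Ew' in E *.
by have [-> ->] := pairs_uniq kp kp' s1K s1K' E.
Qed.

Lemma base_blocks_axis b u w : b \in base_blocks -> u \in b -> w \in b ->
  u - w \in axis -> u = w.
Proof.
move=> /mem_base_blocks[T [s [TT sK ->]]] /scaledP[u0 uT ->] /scaledP[w0 wT ->] H.
apply/eqP; apply: contraLR H => neq.
have [k [s1 [kp s1K _ -> ->]]] := normalize_pair sK TT uT wT neq.
by rewrite inE scaleB /= pairs_neq0.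
Qed.

Lemma base_points_ex g : g \notin axis ->
  exists b u, [/\ b \in base_blocks, u \in b & g - u \in axis].
Proof.
have [ex _ _] := tileP; rewrite inE => /ex[[T u] [s [kp sK gE]]].
exists (scaled s T), (scale s u).
have /andP[TT uT] : (T \in templates) && (u \in T).
  move: kp; rewrite /points !in_cons in_nil orbF => /orP[|/or4P[||| /orP[]]] /eqP[-> ->];
  by rewrite !in_cons !eqxx ?orbT.
split; rewrite ?imset_f //; last by rewrite inE /= gE subrr.
by apply/mem_base_blocks; exists T, s.
Qed.

Lemma base_points_uniq b b' u u' : b \in base_blocks -> b' \in base_blocks ->
  u \in b -> u' \in b' -> u - u' \in axis -> b = b' /\ u = u'.
Proof.
move=> /mem_base_blocks[T [s [TT sK ->]]] /mem_base_blocks[T' [s' [TT' sK' ->]]].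
move=> /scaledP[u0 uT ->] /scaledP[u0' uT' ->].
have [w [s1 [kp s1K -> ->]]] := normalize_point sK TT uT.
have [w' [s1' [kp' s1K' -> ->]]] := normalize_point sK' TT' uT'.
rewrite inE /= subr_eq0 => /eqP E; have [_ un _] := tileP.
by have [[-> ->] ->] := un _ _ _ _ kp kp' s1K s1K' E.
Qed.

Lemma base_points_axis b u : b \in base_blocks -> u \in b -> u \notin axis.
Proof.
move=> /mem_base_blocks[T [s [TT sK ->]]] /scaledP[u0 uT ->].
have [w [s1 [kp s1K _ ->]]] := normalize_point sK TT uT.
by have [_ _ n0] := tileP; rewrite inE /=; apply: n0 kp s1K.
Qed.

(** Size 3 comes from the axis and the two kinds of triples, size 6 from [six_block]; a member of
    [K] is needed for a block of size 6 to occur. *)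
Lemma harmonious_base_blocks :
  linear_space [:: 3; 6]%N (3 * #|R|)%N harmonious_blocks /\ harmonious harmonious_blocks.
Proof.
have H0 : 0 \in axis by rewrite inE.
have HB g h : g \in axis -> h \in axis -> g - h \in axis.
  by rewrite !inE /= => /eqP-> /eqP->; rewrite subr0.
have gt1 b : b \in base_blocks -> (1 < #|b|)%N.
  case/mem_base_blocks=> T [s [TT sK ->]]; rewrite card_scaled //.
  by move: TT; rewrite !inE => /or3P[] /eqP->.
split; last first.
  exact: (difference_family_harmonious H0 HB base_blocks_uniq
    base_blocks_axis base_points_ex base_points_uniq base_points_axis gt1).
have axis3 : #|axis| = 3%N.
  have -> : axis = [set (c, 0) | c : 'Z_3].
    apply/setP=> -[c r]; rewrite inE /=; apply/eqP/imsetP=> [->|[_ _ [_ ->]] //].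
    by exists c.
  by rewrite card_imset ?card_ord // => a b [].
split.
- by rewrite card_prod card_ord.
- move=> b /imset2P[c g]; rewrite in_setU1 => cHD _ ->; rewrite card_shift.
  case/predU1P: cHD => [->|]; first by rewrite axis3.
  case/mem_base_blocks=> T [s [TT sK ->]]; rewrite card_scaled //.
  by move: TT; rewrite !inE => /or3P[] /eqP->.
- have [s sK] := K_gt0; move=> k; rewrite !inE => /orP[] /eqP->.
    exists (shift axis 0); last by rewrite card_shift.
    by apply/imset2P; exists axis 0; rewrite ?inE ?eqxx.
  exists (shift (scaled s six_block) 0); last by rewrite card_shift card_scaled // inE eqxx.
  apply/imset2P; exists (scaled s six_block) 0; rewrite // in_setU1; apply/orP; right.
  by apply/mem_base_blocks; exists six_block, s; rewrite inE eqxx.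
exact: (translates_pair H0 HB base_blocks_ex base_blocks_uniq base_blocks_axis).
Qed.

End BaseBlocks.

(** The inequalities not listed follow by negating listed ones, and x != -x for nonzero x follows
    from 1 != -1. *)
Lemma uniq_signed (R : idomainType) (a b c : R) :
  uniq [:: 0; 1; a; c; -1; b; - c] -> uniq [:: 0; 1; -1; a; - a; c; - c].
Proof.
rewrite /= !inE !negb_or -!andbA !andbT ![0 == _]eq_sym !oppr_eq0.
move=> H; repeat (case/andP: H => ?  H).
have two : (2 : R) != 0 by rewrite -[2]/(1 + 1) addr_eq0.
have aN (x : R) : x != 0 -> x != - x.
  by move=> x0; rewrite -addr_eq0 -mulr2n -mulr_natl mulf_neq0.
repeat (apply/andP; split); rewrite ?aN //;
  first [by rewrite eq_sym | by rewrite -eqr_opp ?opprK | by rewrite -eqr_opp ?opprK eq_sym].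
Qed.

(** * From starters to the three difference conditions *)

Section StarterPairs.
Variable F : finFieldType.
Hypothesis F_mod : (#|F| = 19 %[mod 36])%N.
Variables e t y z : F.
Hypothesis st : starter e t y z.
Local Notation h := (fun x : F => x ^+ class_exp F).

(** Each difference is e - 1 or e^2 - 1 times one of 1, t, -z. As e^2 - 1 = -e^2 (e - 1), these two
    factors have opposite classes, so up to the class of e - 1 the list is the classes of 1, t, -z
    and their negatives. *)
Lemma starter_flat : uniq (0 :: [seq h x | x <- [:: e - 1; e * e - 1; e * t - t;
  e * e * t - t; e * - z - - z; e * e * - z - - z]]).
Proof.
have [e0 + _] := st; have heE := class_exp_omega F_mod e0.
have h2 : h (e * e - 1) = - h (e - 1).
  have -> : e * e - 1 = (e - 1) * (e * e + e + 1) - e * e * (e - 1) by ring.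
  by rewrite /= e0 mulr0 sub0r (class_expN F_mod) !exprMn heE !mul1r.
have -> : e * t - t = (e - 1) * t by ring.
have -> : e * e * t - t = (e * e - 1) * t by ring.
have -> : e * - z - - z = (e - 1) * - z by ring.
have -> : e * e * - z - - z = (e * e - 1) * - z by ring.
have e1 : h (e - 1) != 0.
  (* If e = 1, the differences t - 1 and e t - 1 of the starter would coincide. *)
  rewrite class_exp_eq0 // subr_eq0; have [_ _] := st; apply: contraTneq => ->.
  by rewrite /= !mul1r !in_cons eqxx ?orbT ?andbF.
have -> : uniq (0 :: [seq h x | x <- [:: e - 1; e * e - 1; (e - 1) * t;
    (e * e - 1) * t; (e - 1) * - z; (e * e - 1) * - z]])
  = uniq [seq h (e - 1) * c | c <- [:: 0; 1; - 1; h t; - h t; h (- z); - h (- z)]].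
  by rewrite /= in h2 *; rewrite !exprMn !h2 mulr0 mulr1 !mulrN !mulNr mulr1.
rewrite (map_inj_uniq (mulfI e1)) /= !(class_expN F_mod) expr1n.
move: (t ^+ _) (y ^+ _) (z ^+ _) => a b c u.
by apply: (@uniq_signed _ a b (- c)); rewrite opprK.
Qed.

Lemma starter_skew : uniq (0 :: [seq h x | x <- [:: t - 1; e * t - 1;
  e * e * t - 1; y - -1; z - y; -1 - z]]).
Proof. by have [_ _] := st; rewrite opprK. Qed.

(** Up to powers of [e], which have class 1, these are the negatives of the differences in
    [starter_skew], with the second and third exchanged. *)
Lemma starter_skewN : uniq (0 :: [seq h x | x <- [:: 1 - t; e - t;
  e * e - t; -1 - y; y - z; z - -1]]).
Proof.
have [e0 _ u] := st; have heE := class_exp_omega F_mod e0.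
have e3 : e * (e * e) = 1 by apply: omega3.
have -> : 1 - t = - (t - 1) by ring.
have -> : e - t = - (e * (e * e * t - 1)) by ring: e3.
have -> : e * e - t = - (e * e * (e * t - 1)) by ring: e3.
have -> : -1 - y = - (y + 1) by ring.
have -> : y - z = - (z - y) by ring.
have -> : z - -1 = - (-1 - z) by ring.
rewrite -(map_inj_uniq oppr_inj) /= oppr0 in u.
rewrite [map _ _]/= !(class_expN F_mod) !exprMn heE !mul1r.
have swap (a b c d f g : F) : uniq [:: 0; a; b; c; d; f; g] -> uniq [:: 0; a; c; b; d; f; g].
  rewrite (perm_uniq (s2 := [:: 0; a; c; b; d; f; g])) // !perm_cons.
  by apply/permPl; apply: (perm_catCA [:: _] [:: _]).
exact: swap u.
Qed.

End StarterPairs.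

(** Starters of the factors are combined coordinatewise. The index [i0] makes the product
    nontrivial, so that 1 has a leading coordinate and lies in [class1]. *)
Theorem prod_ring_harmonious (I : finType) (F : I -> finFieldType) :
  (forall i, #|F i| = 19 %[mod 36])%N -> I ->
  (forall i, exists e t y z : F i, starter e t y z) ->
  exists B : {set {set ('Z_3 * prod_ring F)%type}},
    linear_space [:: 3; 6]%N (3 * #|{: prod_ring F}|)%N B /\ harmonious B.
Proof.
move=> F_mod i0 ex.
have {}ex i : exists p : F i * F i * (F i * F i), starter p.1.1 p.1.2 p.2.1 p.2.2.
  by have [e [t [y [z st]]]] := ex i; exists ((e, t), (y, z)).
have [p st] := fin_all_exists ex.
pose e : prod_ring F := [ffun i => (p i).1.1].
pose t : prod_ring F := [ffun i => (p i).1.2].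
pose y : prod_ring F := [ffun i => (p i).2.1].
pose z : prod_ring F := [ffun i => (p i).2.2].
have pE i : [/\ e i = (p i).1.1, t i = (p i).1.2, y i = (p i).2.1 & z i = (p i).2.2].
  by rewrite !ffunE.
have tl (X : eqType) (ks : seq X) (f : X -> prod_ring F) : size ks = 6%N ->
   (forall i, uniq (0 :: [seq f x i ^+ class_exp (F i) | x <- ks])) ->
   tiles (class1 F) ks f.
  move=> s6 u; split; first exact: tile_ex u.
    exact: tile_uniq u.
  exact: tile_mul_neq0 u.
exists (harmonious_blocks (class1 F) e t y z); apply: harmonious_base_blocks.
- apply/ffunP=> i; rewrite !prodE; have [-> _ _ _] := pE i; by have [] := st i.
- move=> s; rewrite !inE lead_mul => [|i]; last first.
    have [-> _ _ _] := pE i; have [e0 _ _] := st i.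
    by apply: contra_eq_neq e0 => ->; rewrite mulr0 !add0r oner_eq0.
  case: (lead s) => // i; rewrite prodE exprMn; have [-> _ _ _] := pE i.
  by have [e0 _ _] := st i; rewrite (class_exp_omega (F_mod i) e0) mulr1.
- exists 1; rewrite inE /lead; case: pickP => [i _|/(_ i0)]; rewrite prodE ?expr1n ?eqxx //.
  by rewrite oner_eq0.
- apply: tl => // i; have [Ee Et Ey Ez] := pE i; have := starter_flat (F_mod i) (st i).
  by rewrite -Et -Ez -Ee; rewrite /= /pair_diff /= !prodE.
- apply: tl => // i; have [Ee Et Ey Ez] := pE i; have := starter_skew (st i).
  by rewrite -Ee -Et -Ey -Ez /= /pair_diff /= !prodE.
- apply: tl => // i; have [Ee Et Ey Ez] := pE i; have := starter_skewN (F_mod i) (st i).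
  by rewrite -Ee -Et -Ey -Ez /= /pair_diff /= !prodE.
- apply: tl => // i; have [Ee Et Ey Ez] := pE i; have [_ + _] := st i.
  by rewrite -Et -Ey -Ez /= !prodE.
Qed.

(** * Starters in large fields *)

Lemma card_expr_le (F : finFieldType) (n : nat) (c : F) :
  (0 < n)%N -> (#|[set x : F | x ^+ n == c]| <= n)%N.
Proof.
move=> n0; rewrite cardE -ltnS -(size_XnsubC c n0).
apply: max_poly_roots; rewrite ?enum_uniq //.
  by rewrite -size_poly_eq0 size_XnsubC.
by apply/allP=> x; rewrite mem_enum inE rootE !hornerE subr_eq0.
Qed.

(** * Sizes of the power classes and the choice of t *)

Section PowerClasses.
Variable F : finFieldType.
Hypothesis F_mod : (#|F| = 19 %[mod 36])%N.
Local Notation k := (class_exp F).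
Local Notation h := (fun x : F => x ^+ k).

Definition sixth_roots : {set F} := [set c | c ^+ 6 == 1].
Definition power_class (c : F) : {set F} := [set x | x ^+ k == c].
Local Notation U := sixth_roots.

Lemma sixth_root_neq0 c : c \in U -> c != 0.
Proof. by rewrite inE; apply: contraTneq => ->; rewrite expr0n eq_sym oner_eq0. Qed.

Lemma class_exp_root x : x != 0 -> h x \in U.
Proof. by move=> x0; rewrite inE /= (expr_class_exp6 F_mod x0). Qed.

Lemma sixth_rootN c : c \in U -> - c \in U.
Proof. by rewrite !inE (exprNn c) -signr_odd mul1r. Qed.

Lemma sixth_rootM c d : c \in U -> d \in U -> c * d \in U.
Proof. by rewrite !inE exprMn => /eqP-> /eqP->; rewrite mulr1. Qed.

(** With at most six sixth roots of unity and at most k elements per class, this total forces both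
    bounds to be attained. *)
Lemma sum_power_classes : (\sum_(c in U) #|power_class c| = 6 * k)%N.
Proof.
have <- : #|[set x : F | x != 0]| = (6 * k)%N.
  have := cardsC1 (0 : F); rewrite (card_class_exp F_mod) /= => <-.
  by apply: eq_card => x; rewrite !inE.
rewrite -[RHS]sum1_card [RHS](partition_big h [in U]) /=; last first.
  by move=> x; rewrite !inE => x0; rewrite (expr_class_exp6 F_mod x0).
apply: eq_bigr => c cU; rewrite -sum1_card; apply: eq_bigl => x.
rewrite !inE; case: eqP => [Ex|]; rewrite ?andbF // andbT.
by rewrite -(class_exp_eq0 F_mod) Ex sixth_root_neq0.
Qed.

Lemma card_power_class_le c : (#|power_class c| <= k)%N.
Proof. exact: card_expr_le (class_exp_gt0 F_mod). Qed.

Lemma card_sixth_roots : #|U| = 6%N.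
Proof.
apply/eqP; rewrite eqn_leq card_expr_le //=.
have: (6 * k <= #|U| * k)%N.
  by rewrite -sum_power_classes -sum_nat_const leq_sum // => c _; apply: card_power_class_le.
by rewrite leq_pmul2r // class_exp_gt0.
Qed.

Lemma card_power_class c : c \in U -> #|power_class c| = k.
Proof.
move=> cU; apply/eqP; rewrite eqn_leq card_power_class_le /=.
have := sum_power_classes; rewrite (bigD1 c) //= => E.
rewrite -(leq_add2r (\sum_(i in U | i != c) #|power_class i|)) E.
have U5 : #|[pred i in U | i != c]| = 5%N.
  have := cardD1 c U; rewrite cU card_sixth_roots => -[->].
  by apply: eq_card => x; rewrite !inE andbC.
rewrite (mulSn 5) leq_add2l -U5 -sum_nat_const.
by apply: leq_sum => i _; apply: card_power_class_le.
Qed.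

(** The map sending y to (y - a)/(y - b) is injective, and on these y its values are k-th roots of
    unity other than 1. *)
Lemma card_same_class (a b : F) : a != b ->
  (#|[set y | h (y - a) == h (y - b)]%R| <= k.-1)%N.
Proof.
move=> neq; set S := [set y | _].
have SP y : y \in S -> y - a != 0 /\ y - b != 0.
  rewrite inE => /eqP E; split; apply: contra neq => /eqP E0; move/eqP: E.
    rewrite E0 expr0n gtn_eqF ?(class_exp_gt0 F_mod) // eq_sym (class_exp_eq0 F_mod).
    by move/eqP: E0; rewrite !subr_eq0 => /eqP->.
  rewrite E0 expr0n gtn_eqF ?(class_exp_gt0 F_mod) // (class_exp_eq0 F_mod).
  by move/eqP: E0; rewrite !subr_eq0 => /eqP->; rewrite eq_sym.
have -> : k.-1 = #|power_class 1 :\ 1|.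
  by rewrite -(card_power_class (c := 1)) ?inE ?expr1n // (cardsD1 1) inE expr1n eqxx.
rewrite -(card_in_imset (f := fun y => (y - a) / (y - b)) (D := S)); last first.
  move=> y y' /SP[ya yb] /SP[ya' yb'] /= /eqP; rewrite eqr_div // => /eqP E.
  have /eqP : (y - y') * (a - b) = 0.
    have -> : (y - y') * (a - b) = (y - a) * (y' - b) - (y' - a) * (y - b) by ring.
    by rewrite E subrr.
  by rewrite mulf_eq0 !subr_eq0 (negPf neq) orbF => /eqP.
apply: subset_leq_card; apply/subsetP=> _ /imsetP[y yS ->]; have [ya yb] := SP y yS.
rewrite !inE; apply/andP; split.
  by rewrite -(inj_eq (mulIf yb)) mul1r divfK // (inj_eq (addrI _)) eqr_opp.
by move: yS; rewrite inE expr_div_n => /eqP->; rewrite divff // class_exp_eq0.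
Qed.

(** Take e = c^2 for one of the six sixth roots of unity [c] with c^2 != 1. *)
Lemma omega_exists : exists2 e : F, e * e + e + 1 = 0 & e != 1.
Proof.
have: ~~ (U \subset [set c | c ^+ 2 == 1]).
  apply: contraTN isT => /subset_leq_card; rewrite card_sixth_roots => H.
  by have := leq_trans H (card_expr_le 1 (isT : 0 < 2)%N).
case/subsetPn=> c; rewrite !inE => /eqP c6; rewrite -subr_eq0 => c2.
exists (c ^+ 2); last by rewrite -subr_eq0.
apply: (mulfI c2); rewrite mulr0.
have -> : (c ^+ 2 - 1) * (c ^+ 2 * c ^+ 2 + c ^+ 2 + 1) = c ^+ 6 - 1 by ring.
by rewrite c6 subrr.
Qed.

(* At most 1 + 2k + 3(k-1) < 6k+1 elements violate one of the conditions. *)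
Lemma ratio_exists (e : F) : e * e + e + 1 = 0 -> e != 1 ->
  exists t, [/\ t != 0, (h t) ^+ 2 != 1
    & uniq [:: h (t - 1); h (e * t - 1); h (e * e * t - 1)]].
Proof.
move=> e0 e1; have heE := class_exp_omega F_mod e0.
have e3 : e * (e * e) = 1.
  apply/subr0_eq; have -> : e * (e * e) - 1 = (e - 1) * (e * e + e + 1) by ring.
  by rewrite e0 mulr0.
have e00 : e != 0 by apply: contra_eq_neq e0 => ->; rewrite mulr0 !add0r oner_eq0.
pose B a b := [set y : F | h (y - a) == h (y - b)].
pose bad := [set 0] :|: [set x : F | x ^+ (k * 2) == 1] :|: B 1 (e * e)
  :|: B 1 e :|: B e (e * e).
have: ~~ ([set: F] \subset bad).
  apply/negP=> /subset_leq_card; rewrite cardsT (card_class_exp F_mod).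
  have cU (S T : {set F}) m n : (#|S| <= m -> #|T| <= n -> #|S :|: T| <= m + n)%N.
    by move=> Sm Tn; rewrite cardsU (leq_trans (leq_subr _ _)) ?leq_add.
  have k0 := class_exp_gt0 F_mod.
  have ee1 : 1 != e * e by apply: contra e1 => /eqP E; rewrite -e3 -E mulr1.
  have eee : e != e * e.
    by rewrite -{1}[e]mulr1 (inj_eq (mulfI e00)) eq_sym.
  have e1' : 1 != e by rewrite eq_sym.
  have c1 : (#|B 1%R (e * e)%R| <= k.-1)%N := card_same_class ee1.
  have c2 : (#|B 1%R e| <= k.-1)%N := card_same_class e1'.
  have c3 : (#|B e (e * e)%R| <= k.-1)%N := card_same_class eee.
  have c4 : (#|[set x : F | x ^+ (k * 2) == 1%R]| <= k * 2)%N.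
    by apply: card_expr_le; rewrite muln_gt0 k0.
  have: (#|bad| <= 1 + k * 2 + k.-1 + k.-1 + k.-1)%N by rewrite !cU // cards1.
  move=> b1 b2; have := leq_trans b2 b1; clear - k0; move: (k) k0 => n; lia.
case/subsetPn=> t _; rewrite !in_setU !negb_or !inE -!andbA => /and5P[t0 t2 b1 b2 b3].
exists t; split=> //; first by rewrite -exprM.
(* Since [e] has class 1, the three differences have the classes of t - 1, t - e^2 and t - e, as
   compared in [bad]. *)
have -> : e * t - 1 = e * (t - e * e) by ring: e3.
have -> : e * e * t - 1 = e * e * (t - e) by ring: e3.
rewrite /= !exprMn heE !mul1r !in_cons !in_nil !negb_or b1 b2 !andbT /=.
by rewrite eq_sym.
Qed.
End PowerClasses.

(** * Second moment bound for differences in a given class *)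

Section Discrepancy.
Variable F : finFieldType.
Hypothesis F_mod : (#|F| = 19 %[mod 36])%N.
Local Notation k := (class_exp F).
Local Notation h := (fun x : F => x ^+ k).
Local Notation U := (sixth_roots F).

Definition class_degree (X : {set F}) (y c : F) : nat :=
  #|[set x in X | h (y - x) == c]|.

Lemma class_degreeE X y c : class_degree X y c = (\sum_(x in X) (h (y - x)%R == c))%N.
Proof.
rewrite /class_degree -sum1_card big_mkcond [RHS]big_mkcond /=.
by apply: eq_bigr => x _; rewrite inE; do 2!case: ifP => //=; case: eqP.
Qed.

Lemma sum_class_degree X y : (\sum_(c in U) class_degree X y c = #|X :\ y|)%N.
Proof.
rewrite -[RHS]sum1_card [RHS](partition_big (fun x => h (y - x)) [in U]) /=; last first.
  move=> x; rewrite !inE => /andP[xy _].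
  by apply/eqP; apply: (expr_class_exp6 F_mod); rewrite subr_eq0 eq_sym.
apply: eq_bigr => c cU; rewrite /class_degree -sum1_card; apply: eq_bigl => x.
rewrite !inE; have [->|//] := eqVneq x y; rewrite subrr expr0n.
by rewrite gtn_eqF ?(class_exp_gt0 F_mod) // eq_sym (negPf (sixth_root_neq0 cU)) andbF.
Qed.

(** The sum counts triples (y, x, x') with y - x and y - x' in the same class. A pair with x = x'
    admits 6k values of y, and by [card_same_class] any other pair at most k - 1. *)
Lemma sum_class_degree_sqr X :
  (\sum_y \sum_(c in U) class_degree X y c * class_degree X y c
     <= #|X| * (6 * k + #|X|.-1 * k.-1))%N.
Proof.
have -> : (\sum_y \sum_(c in U) class_degree X y c * class_degree X y c =
    \sum_(x in X) \sum_(x' in X) \sum_y \sum_(c in U)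
      (h (y - x)%R == c) * (h (y - x')%R == c))%N.
  under eq_bigr => y _.
    under eq_bigr => c _ do rewrite class_degreeE big_distrlr /=.
    rewrite exchange_big /=; under eq_bigr => x _ do rewrite exchange_big /=.
    over.
  rewrite exchange_big /=; apply: eq_bigr => x _; exact: exchange_big.
have inner (x x' y : F) : (\sum_(c in U) (h (y - x)%R == c) * (h (y - x')%R == c)
    <= (y \in [set y | (y - x != 0) && (h (y - x) == h (y - x'))]%R))%N.
  rewrite inE; case: (altP (y - x =P 0)) => [->|yx].
    rewrite big1 // => c cU; rewrite expr0n gtn_eqF ?(class_exp_gt0 F_mod) //.
    by rewrite eq_sym (negPf (sixth_root_neq0 cU)).
  rewrite (bigD1 (h (y - x))) ?(class_exp_root F_mod) //= eqxx mul1n big1 ?addn0.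
    by rewrite eq_sym.
  by move=> c /andP[_ neq]; rewrite eq_sym (negPf neq).
have innerS (x x' : F) :
    (\sum_y \sum_(c in U) (h (y - x)%R == c) * (h (y - x')%R == c)
      <= #|[set y | (y - x != 0) && (h (y - x) == h (y - x'))]%R|)%N.
  by rewrite -sum1_card [X in (_ <= X)%N]big_mkcond; apply: leq_sum => y _;
    have := inner x x' y; case: (y \in _).
rewrite -sum_nat_const; apply: leq_sum => x xX.
rewrite (bigD1 x) //=; apply: leq_add.
  apply: leq_trans (innerS x x) _.
  rewrite -[(6 * k)%N]/((6 * k).+1.-1) -(card_class_exp F_mod) -(cardC1 x).
  by apply: subset_leq_card; apply/subsetP=> y; rewrite !inE subr_eq0 => /andP[].
have -> : (#|X|.-1 = #|[pred x' in X | x' != x]|)%N.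
  by rewrite (cardD1 x) xX; apply: eq_card => x'; rewrite !inE andbC.
rewrite -sum_nat_const; apply: leq_sum => x' /andP[_ neq].
apply: leq_trans (innerS x x') _.
rewrite eq_sym in neq; apply: leq_trans (card_same_class F_mod neq).
by apply: subset_leq_card; apply/subsetP=> y; rewrite !inE => /andP[].
Qed.

Lemma sum_card_rem_sqr X :
  (\sum_(y : F) (#|X :\ y|%:Z * #|X :\ y|%:Z) = (#|F|%:Z - #|X|%:Z) * (#|X|%:Z * #|X|%:Z)
    + #|X|%:Z * ((#|X|%:Z - 1) * (#|X|%:Z - 1)) :> int).
Proof.
rewrite (bigID [in X]) /= addrC; congr (_ + _).
  rewrite (eq_bigr (fun=> #|X|%:Z * #|X|%:Z)) => [|y yX]; last first.
    by rewrite (_ : X :\ y = X) //; apply/setDidPl; rewrite disjoint_sym disjoints1.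
  rewrite sumr_const -mulr_natl; congr (_ * _).
  by rewrite -(cardC [in X]) PoszD addrAC subrr add0r natz.
rewrite (eq_bigr (fun=> (#|X|%:Z - 1) * (#|X|%:Z - 1))) => [|y yX].
  by rewrite sumr_const -mulr_natl natz.
by rewrite (cardsD1 y X) yX PoszD [1 + _]addrC addrK.
Qed.

(* Summing the squares over all six classes makes the second moment computable:
   each of the pairs x != x' contributes the number of u != 1 with u^k = 1.  A
   single class is recovered because the six deviations at y add up to 0. *)
Theorem class_discrepancy (X : {set F}) (c : F) : c \in U ->
  \sum_(y : F) ((6 * class_degree X y c)%:Z - #|X :\ y|%:Z) ^+ 2
    <= (25 * (#|X| * #|F|))%:Z.
Proof.
(* Since y - y lies in no class, removing [y] from [X] makes the six deviations cancel exactly. *)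
move=> cU; pose g y c := (6 * class_degree X y c)%:Z - #|X :\ y|%:Z.
have g0 y : \sum_(c in U) g y c = 0.
  rewrite sumrB sumr_const (card_sixth_roots F_mod).
  have -> : \sum_(d in U) (6 * class_degree X y d)%:Z = (6 * \sum_(d in U) class_degree X y d)%N%:Z.
    by rewrite big_distrr /= (big_morph Posz PoszD (erefl (Posz 0))).
  rewrite sum_class_degree; lia.
(* In the sum of (5 g_d + g_c)^2 the term d = c alone is 36 g_c^2, while the cross terms vanish
   because the deviations add up to 0. *)
have gc y : 6 * g y c ^+ 2 <= 5 * \sum_(d in U) g y d ^+ 2.
  have : 36 * g y c ^+ 2 <= \sum_(d in U) (5 * g y d + g y c) ^+ 2.
    have E6 : (5 * g y c + g y c) ^+ 2 = 36 * g y c ^+ 2 by ring.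
    by rewrite (bigD1 c) //= E6 lerDl sumr_ge0 // => d _; apply: sqr_ge0.
  have -> : \sum_(d in U) (5 * g y d + g y c) ^+ 2 =
      25 * (\sum_(d in U) g y d ^+ 2) + 10 * g y c * (\sum_(d in U) g y d) + 6 * g y c ^+ 2.
    rewrite !mulr_sumr -big_split /=.
    have -> : 6 * g y c ^+ 2 = \sum_(d in U) g y c ^+ 2.
      by rewrite sumr_const (card_sixth_roots F_mod) mulr_natl.
    by rewrite -big_split /=; apply: eq_bigr => d _; ring.
  rewrite g0 mulr0 addr0; lia.
have sq : \sum_y \sum_(d in U) g y d ^+ 2 <= 30 * (#|X|%:Z * (#|F|%:Z - #|X|%:Z)).
  have -> : \sum_y \sum_(d in U) g y d ^+ 2 =
     36 * (\sum_y \sum_(d in U) class_degree X y d * class_degree X y d)%N%:Z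
     - 6 * \sum_(y : F) (#|X :\ y|%:Z * #|X :\ y|%:Z).
    have gS y : \sum_(d in U) g y d ^+ 2 =
      36 * (\sum_(d in U) class_degree X y d * class_degree X y d)%N%:Z
        - 6 * (#|X :\ y|%:Z * #|X :\ y|%:Z).
      rewrite (eq_bigr (fun d => 36 * (class_degree X y d * class_degree X y d)%:Z
        + - 12 * #|X :\ y|%:Z * (class_degree X y d)%:Z + #|X :\ y|%:Z * #|X :\ y|%:Z)).
        rewrite !big_split /= -!mulr_sumr sumr_const (card_sixth_roots F_mod).
        rewrite -!(big_morph Posz PoszD (erefl (Posz 0))) sum_class_degree -mulr_natl.
        by ring.
      by move=> d _; rewrite /g !PoszM; ring.
    rewrite (eq_bigr _ (fun y _ => gS y)).
    rewrite sumrB -!mulr_sumr (big_morph Posz PoszD (erefl (Posz 0))); congr (_ - _).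
  have := sum_class_degree_sqr X; rewrite sum_card_rem_sqr (card_class_exp F_mod).
  set S := (\sum_y _)%N; have := class_exp_gt0 F_mod; move: (k) #|X| S => n m S.
  case: n => // n _; case: m => [|m] /=.
    rewrite mul0n leqn0 => /eqP->; lia.
  move=> leS; lia.
(* The factor 5/6 turns the 30 of [sq] into 25. *)
have : 6 * (\sum_y g y c ^+ 2) <= 5 * (\sum_y \sum_(d in U) g y d ^+ 2).
  by rewrite !mulr_sumr; apply: ler_sum => y _; apply: gc.
move=> gle; change (\sum_y g y c ^+ 2 <= (25 * (#|X| * #|F|))%:Z); move: gle.
move: (\sum_y \sum_(d in U) g y d ^+ 2) (\sum_y g y c ^+ 2) sq => B A.
move: #|X| #|F| => m q; nia.
Qed.

End Discrepancy.

Section SignedTriples.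
Variable F : finFieldType.
Hypothesis F_mod : (#|F| = 19 %[mod 36])%N.
Local Notation k := (class_exp F).
Local Notation h := (fun x : F => x ^+ k).
Local Notation U := (sixth_roots F).

Lemma class_exp_opp1 : h (-1) = -1.
Proof. by rewrite /= (class_expN F_mod) expr1n. Qed.

(** Multiplication by -p, of class 1 when p has class -1, preserves [W] and all classes, so the
    deviation is the same at all k elements of class -1. The averaged bound thus becomes a bound at
    the single point -1. *)
Lemma cone_degree (W : {set F}) c : c \in U ->
  (forall u x, h u = 1 -> x \in W -> u * x \in W) -> -1 \notin W ->
  ((6 * class_degree W (-1) c)%:Z - #|W|%:Z) ^+ 2 * k%:Z <= (25 * (#|W| * #|F|))%:Z.
Proof.
move=> cU coneW W1.
have neg p : p \in power_class (-1 : F) -> h (- p) = 1 /\ p \notin W.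
  rewrite inE => /eqP hp; have hNp : h (- p) = 1 by rewrite /= (class_expN F_mod) hp opprK.
  split=> //; apply: contra W1 => pW; have p0 : p != 0.
    by rewrite -(class_exp_eq0 F_mod) hp oppr_eq0 oner_eq0.
  have -> : -1 = (- p)^-1 * p by rewrite invrN mulNr mulVf.
  by apply: coneW pW; rewrite /= exprVn hNp invr1.
apply: le_trans (class_discrepancy F_mod W cU).
rewrite (bigID [in power_class (-1 : F)]) /= -[leLHS]addr0 lerD //; last first.
  by apply: sumr_ge0 => y _; apply: sqr_ge0.
have kE : k = #|power_class (-1 : F)|.
  by rewrite (card_power_class F_mod) // sixth_rootN // inE expr1n.
have -> : ((6 * class_degree W (-1) c)%:Z - #|W|%:Z) ^+ 2 * k%:Z =
  \sum_(p in power_class (-1 : F)) ((6 * class_degree W (-1) c)%:Z - #|W|%:Z) ^+ 2.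
  by rewrite sumr_const -kE -mulr_natr natz.
apply: ler_sum => p /neg[hp pW].
have -> : W :\ p = W by apply/setDidPl; rewrite disjoint_sym disjoints1.
suff -> : class_degree W p c = class_degree W (-1) c by [].
have p0 : - p != 0 by rewrite -(class_exp_eq0 F_mod) hp oner_eq0.
have hm x : h (- p * x) = h x by rewrite /= exprMn hp mul1r.
rewrite /class_degree -[RHS](card_imset _ (mulfI p0)); apply: eq_card => x.
rewrite !inE; apply/andP/imsetP=> [[xW hx]|[y + ->]].
  exists ((- p)^-1 * x); last by rewrite mulVKf.
  rewrite !inE coneW //= ?exprVn ?hp ?invr1 //.
  by rewrite -(hm (_ - _)) mulrBr mulVKf // mulrN1 opprK.
rewrite !inE => /andP[yW hy]; split; first exact: coneW.
by rewrite -(eqP hy) -(hm (_ - y)) mulrBr mulrN1 opprK.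
Qed.

(** In characteristic 2, X^6 - 1 = (X^3 - 1)^2 would have at most three roots instead of six. *)
Lemma two_neq0 : (2 : F) != 0.
Proof.
apply/eqP=> two; have: U \subset [set c | c ^+ 3 == 1].
  apply/subsetP=> c; rewrite !inE => /eqP c6; rewrite -subr_eq0 -sqrf_eq0; apply/eqP.
  have -> : (c ^+ 3 - 1) ^+ 2 = (c ^+ 6 - 1) + 2 * (1 - c ^+ 3) by ring.
  by rewrite c6 two subrr mul0r addr0.
move/subset_leq_card; rewrite (card_sixth_roots F_mod) => H.
by have := leq_trans H (card_expr_le 1 (isT : 0 < 3)%N).
Qed.

Lemma three_neq0 : (3 : F) != 0.
Proof.
apply/eqP=> three; have: U \subset [set c | c ^+ 2 == 1].
  apply/subsetP=> c; rewrite !inE => /eqP c6.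
  have E : (c ^+ 2 - 1) ^+ 3 = (c ^+ 6 - 1) + 3 * (c ^+ 2 - c ^+ 4) by ring.
  by move: E; rewrite c6 three subrr mul0r addr0 => /eqP; rewrite expf_eq0 /= subr_eq0.
move/subset_leq_card; rewrite (card_sixth_roots F_mod) => H.
by have := leq_trans H (card_expr_le 1 (isT : 0 < 2)%N).
Qed.

(** The squares 1, m^2, m^4 of 1, m, w are distinct, and a nonzero element differs from its
    negative. *)
Lemma uniq_signed_triple (m w : F) : m ^+ 6 = 1 -> m ^+ 2 != 1 -> w ^+ 2 = m ^+ 4 ->
  uniq [:: 0; 1; m; w; -1; - m; - w].
Proof.
move=> m6 m2 w2.
have m0 : m != 0 by apply: contra_eq_neq m6 => ->; rewrite expr0n eq_sym oner_eq0.
have w0 : w != 0 by rewrite -sqrf_eq0 w2 expf_neq0.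
have /norP[m1 mN1] : ~~ ((m == 1) || (m == -1)) by rewrite -sqrf_eq1.
have m4 : m ^+ 4 != 1.
  by apply: contra m2 => /eqP m4; rewrite -m6 (exprD m 4 2) m4 mul1r.
have /norP[w1 wN1] : ~~ ((w == 1) || (w == -1)) by rewrite -sqrf_eq1 w2.
have /norP[wm wNm] : ~~ ((w == m) || (w == - m)).
  rewrite -eqf_sqr w2 (exprD m 2 2) -[X in _ == X]mulr1 (inj_eq (mulfI _)) //.
  by rewrite expf_neq0.
have aN (x : F) : x != 0 -> x != - x.
  by move=> x0; rewrite -addr_eq0 -mulr2n -mulr_natl mulf_neq0 ?two_neq0.
have n1 : (1 : F) != 0 := oner_neq0 F.
rewrite /= !inE !negb_or -!andbA !andbT ![0 == _]eq_sym !oppr_eq0.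
repeat (apply/andP; split); rewrite ?aN //;
  first [by rewrite eq_sym | by rewrite -eqr_opp ?opprK | by rewrite -eqr_opp ?opprK eq_sym].
Qed.

End SignedTriples.

(** [A] is near n/6 and [B] near n/3. The deviation bounds give A >= 2n/15 and B >= 172n/600, so AB
    is at least 152n, just above 25q, which is about 150n. *)
Lemma degrees_large (A B n q : nat) : q = (6 * n).+1 -> (4000 <= n)%N ->
  ((6 * A)%:Z - n%:Z) ^+ 2 * n%:Z <= (25 * (n * q))%:Z ->
  ((6 * B)%:Z - (2 * n)%N%:Z) ^+ 2 * n%:Z <= (25 * (2 * n * q))%:Z ->
  (25 * q < A * B)%N.
Proof.
move=> -> n4 HA HB; have n0 : 0 < n%:Z by lia.
have n2 : 4000 * n%:Z <= n%:Z * n%:Z by rewrite ler_pM2r //; lia.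
have {}HA : ((6 * A)%:Z - n%:Z) ^+ 2 <= 25 * (6 * n%:Z + 1).
  rewrite -(ler_pM2r n0); apply: le_trans HA _; lia.
have {}HB : ((6 * B)%:Z - (2 * n)%N%:Z) ^+ 2 <= 50 * (6 * n%:Z + 1).
  rewrite -(ler_pM2r n0); apply: le_trans HB _; lia.
have A1 : 2 * n%:Z <= 15 * A%:Z.
  rewrite leNgt; apply/negP=> lt.
  have x5 : n%:Z <= 5 * (n%:Z - (6 * A)%:Z) by lia.
  have := ler_pM (ltW n0) (ltW n0) x5 x5; rewrite expr2 in HA; lia.
have B1 : 172 * n%:Z <= 600 * B%:Z.
  rewrite leNgt; apply/negP=> lt.
  have x5 : 28 * n%:Z <= 100 * ((2 * n)%N%:Z - (6 * B)%:Z) by lia.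
  have p : 0 <= 28 * n%:Z by lia.
  have := ler_pM p p x5 x5; rewrite expr2 in HB; lia.
have n2_ge0 := mulr_ge0 (isT : 0 <= 2 :> int) (ltW n0).
have n172_ge0 := mulr_ge0 (isT : 0 <= 172 :> int) (ltW n0).
have := ler_pM n2_ge0 n172_ge0 A1 B1.
lia.
Qed.

Section LargeFields.
Variable F : finFieldType.
Hypothesis F_mod : (#|F| = 19 %[mod 36])%N.
Local Notation k := (class_exp F).
Local Notation h := (fun x : F => x ^+ k).
Local Notation U := (sixth_roots F).

(** Once [t] is fixed, the classes [i], [j], [l] missed by its three differences are assigned to y +
    1, -1 - z and z - y. The first two conditions and the classes of y and z define [Y] and [Z]; the
    discrepancy bound supplies the third. *)
Lemma starter_large : (4000 <= k)%N -> exists e t y z : F, starter e t y z.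
Proof.
move=> k_large; have [e e0 e1] := omega_exists F_mod.
have [t [t0 t2 tU]] := ratio_exists F_mod e0 e1.
pose a := h (t - 1); pose b := h (e * t - 1); pose c := h (e * e * t - 1).
pose m := h t; have mU : m \in U by exact: (class_exp_root F_mod t0).
have m2 : m ^+ 2 != 1 by [].
have m0 := sixth_root_neq0 mU.
have m6 : m ^+ 6 = 1 by move: mU; rewrite inE => /eqP.
have m1 : (m != 1) && (m != -1) by rewrite -negb_or -sqrf_eq1.
have : (2 < #|U :\: [set a; b; c]|)%N.
  have : (#|U :&: [set a; b; c]| <= #|[set a; b; c]|)%N by rewrite subset_leq_card ?subsetIr.
  by rewrite cardsD (card_sixth_roots F_mod) !(cardsU, cards1); lia.
case/card_gt2P=> i [j [l [[iD jD lD] [ij jl li]]]].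
have DU x : x \in U :\: [set a; b; c] -> x \in U by case/setDP.
(* Both signs are allowed for z because z and -z both occur in the list; this doubles the supply of
   candidates. *)
pose Wy := power_class (- m); pose Wz := power_class (m ^+ 2) :|: power_class (- m ^+ 2).
have cardWy : #|Wy| = k by rewrite (card_power_class F_mod) ?sixth_rootN.
have m2U : m ^+ 2 \in U by rewrite expr2 sixth_rootM.
have two := two_neq0 F_mod.
have neqN (x : F) : x != 0 -> x != - x.
  by move=> x0; rewrite -addr_eq0 -mulr2n -mulr_natl mulf_neq0.
have cardWz : #|Wz| = (2 * k)%N.
  rewrite cardsU !(card_power_class F_mod) ?sixth_rootN // (_ : _ :&: _ = set0).
    by rewrite cards0 subn0 mul2n addnn.
  apply/setP=> x; rewrite !inE; apply/negP=> /andP[/eqP-> ].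
  by rewrite (negPf (neqN _ (expf_neq0 _ m0))).
have coneC d u x : h u = 1 -> x \in power_class d -> u * x \in power_class d.
  by rewrite !inE exprMn => ->; rewrite mul1r.
pose Y := [set y in Wy | h (-1 - y) == - i].
pose Z := [set z in Wz | h (-1 - z) == j].
have WzP z : z \in Wz -> h z = m ^+ 2 \/ h z = - m ^+ 2.
  by rewrite !inE => /orP[] /eqP; [left|right].
have YZ : (25 * #|F| < #|Y| * #|Z|)%N.
  have Wy1 : -1 \notin Wy by rewrite inE class_exp_opp1 // eqr_opp eq_sym; case/andP: m1.
  have HY := cone_degree F_mod (_ : - i \in U) (fun u x => @coneC _ u x) Wy1.
  rewrite -/Wy cardWy in HY.
  have coneZ u x : h u = 1 -> x \in Wz -> u * x \in Wz.
    by move=> hu; rewrite !in_setU => /orP[] /(coneC _ _ _ hu)->; rewrite ?orbT.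
  have HZ := cone_degree F_mod (_ : j \in U) coneZ; rewrite cardWz in HZ.
  apply: (degrees_large (card_class_exp F_mod) k_large (HY _) (HZ _ _));
    rewrite ?sixth_rootN ?DU //.
  apply/negP=> /WzP Hw; have: (-1 : F) ^+ 2 = m ^+ 4.
    rewrite -(class_exp_opp1 F_mod); case: Hw => /= ->; first by rewrite -exprM.
    by rewrite sqrrN -exprM.
  rewrite sqrrN expr1n => m4; case/negP: m2.
  by rewrite -m6 (exprD m 4 2) -m4 mul1r.
have [y yY [z zZ hzy]] : exists2 y, y \in Y & exists2 z, z \in Z & h (z - y) = l.
  have [/existsP[y /andP[yY /existsP[z /andP[zZ /eqP hzy]]]]|none] :=
    boolP [exists y in Y, [exists z in Z, h (z - y) == l]].
    by exists y => //; exists z.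
  have lU : - l \in U by rewrite sixth_rootN ?DU.
  (* If no pair works, each y in [Y] has degree 0 into [Z] for class -l and contributes |Z|^2. Then
     |Y| |Z|^2 <= 25 |Z| q, against [YZ]. *)
  have := class_discrepancy F_mod Z lU.
  have Yle : (#|Y| * #|Z| ^ 2)%N%:Z <=
    \sum_y ((6 * class_degree Z y (- l))%:Z - #|Z :\ y|%:Z) ^+ 2.
    rewrite (bigID [in Y]) /= -[leLHS]addr0 lerD //; last first.
      by apply: sumr_ge0 => y _; apply: sqr_ge0.
    have -> : (#|Y| * #|Z| ^ 2)%N%:Z = \sum_(y in Y) (#|Z| ^ 2)%N%:Z.
      by rewrite sumr_const -mulr_natl natz PoszM.
    apply: ler_sum => y yY; have -> : class_degree Z y (- l) = 0%N.
      apply/eqP; rewrite cards_eq0; apply/eqP/setP=> z; rewrite in_set in_set0.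
      apply: contraNF none => /andP[zZ hz]; apply/existsP; exists y; rewrite yY.
      apply/existsP; exists z; rewrite zZ /= -opprB (class_expN F_mod).
      by rewrite (eqP hz) opprK.
    (* The class -m of y is neither m^2 nor -m^2: squaring would give m^2 = 1. *)
    have -> : Z :\ y = Z.
      apply/setDidPl; rewrite disjoint_sym disjoints1; apply/negP.
      rewrite inE => /andP[/WzP Hw _]; move: yY; rewrite !inE => /andP[/eqP hy _].
      have : (- m) ^+ 2 = m ^+ 4.
        by rewrite -hy; case: Hw => /= ->; rewrite ?sqrrN -exprM.
      rewrite sqrrN (exprD m 2 2) -[LHS]mulr1 => /(mulfI (expf_neq0 _ m0)) /esym E.
      by rewrite E eqxx in m2.
    by rewrite muln0 sub0r sqrrN PoszM.
  move/(le_trans Yle); rewrite lez_nat expnS expn1 mulnA; move: YZ.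
  move: #|Y| #|Z| #|F| => p q r lt1 lt2.
  have q0 : (0 < q)%N by rewrite lt0n; apply: contraTneq lt1 => ->; rewrite muln0.
  by move: lt2; rewrite -mulnA mulnCA [(25 * _)%N]mulnCA leq_pmul2l // leqNgt lt1.
have hy : h y = - m by move: yY; rewrite !inE => /andP[/eqP].
have hy1 : h (y + 1) = i.
  have -> : y + 1 = - (-1 - y) by ring.
  by move: yY; rewrite !inE /= (class_expN F_mod) => /andP[_ /eqP->]; rewrite opprK.
have hz1 : h (-1 - z) = j by move: zZ; rewrite !inE => /andP[_ /eqP].
have hz : h z = m ^+ 2 \/ h z = - m ^+ 2 by move: zZ; rewrite inE => /andP[/WzP].
exists e, t, y, z; split=> //.
  have := uniq_signed_triple F_mod m6 m2 (w := h (- z)).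
  rewrite /= !(class_expN F_mod) expr1n hy opprK; apply.
  by case: hz => /= ->; rewrite ?sqrrN -exprM.
have heE := class_exp_omega F_mod e0.
have nz x : h x = 1 -> h (x * t - 1) != 0.
  move=> hx; rewrite (class_exp_eq0 F_mod) subr_eq0; case/andP: m1 => + _.
  apply: contra => /eqP E; have : h (x * t) = m by rewrite /= exprMn hx mul1r.
  by rewrite /= E expr1n => <-.
have a0 : a != 0 by rewrite /a -[t]mul1r nz //= expr1n.
have b0 : b != 0 by rewrite nz.
have c0 : c != 0 by rewrite nz //= exprMn heE mulr1.
rewrite [map _ _]/= hy1 hzy hz1 -/a -/b -/c.
move: tU; rewrite -/a -/b -/c => tU.
have nz' x : x \in U :\: [set a; b; c] -> x != 0 by move/DU/sixth_root_neq0.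
move: (iD) (jD) (lD); rewrite !in_setD !in_setU !in_set1 !negb_or -!andbA.
move=> /and4P[ia ib ic _] /and4P[ja jb jc _] /and4P[la lb lc _].
move: tU; rewrite /= !inE !negb_or -!andbA !andbT ![0 == _]eq_sym.
move=> /and3P[ab ac bc]; have [i0 j0 l0] := And3 (nz' _ iD) (nz' _ jD) (nz' _ lD).
by repeat (apply/andP; split); first [done | rewrite eq_sym].
Qed.

End LargeFields.

(** * Starters in small fields *)

(* (a, b, c) stands for a + b r + c r^2 where r^3 = g; only the fields of order
   7^3 and 19^3 need r. *)
Definition triple : Type := N * N * N.

(** * Computable arithmetic for checking explicit starters *)

Section TripleArithmetic.
Variables p g : N.
Local Notation "n %%% p" := (N.modulo n p) (at level 40).
Local Notation addN := N.add.
Local Notation mulN := N.mul.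

Definition triple_add (x y : triple) : triple :=
  let '(a, b, c) := x in let '(a', b', c') := y in
  (addN a a' %%% p, addN b b' %%% p, addN c c' %%% p).

Definition triple_opp (x : triple) : triple :=
  let '(a, b, c) := x in let m := N.pred p in
  (mulN m a %%% p, mulN m b %%% p, mulN m c %%% p).

Definition triple_mul (x y : triple) : triple :=
  let '(a, b, c) := x in let '(a', b', c') := y in
  (addN (mulN a a') (mulN g (addN (mulN b c') (mulN c b'))) %%% p,
   addN (addN (mulN a b') (mulN b a')) (mulN g (mulN c c')) %%% p,
   addN (addN (mulN a c') (mulN b b')) (mulN c a') %%% p).

Fixpoint triple_pow (x : triple) (n : positive) : triple :=
  match n with
  | xH => x
  | xO n => let y := triple_pow x n in triple_mul y y
  | xI n => let y := triple_pow x n in triple_mul x (triple_mul y y)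
  end.

Definition triple1 : triple := (1, 0, 0)%bin.

(** Different triples could have equal values in the field. The k-th powers are therefore also
    required to lie among the six triples [roots], whose values are shown to be distinct. *)
Definition triple_starter (q : N) (e t y z : triple) : bool :=
  if N.div q 6 is Npos k then
    let e2 := triple_mul e e in
    let sub x y := triple_add x (triple_opp y) in
    let opp1 := triple_opp triple1 in
    let roots := [:: triple1; e; e2; opp1; triple_opp e; triple_opp e2] in
    let complete s :=
      let hs := [seq triple_pow x k | x <- s] in uniq hs && all [in roots] hs in
    [&& q == addN (mulN 6 (Npos k)) 1,
        triple_add (triple_add e2 e) triple1 == (0, 0, 0)%bin,
        complete [:: triple1; t; triple_opp z; opp1; y; z]
      & complete [:: sub t triple1; sub (triple_mul e t) triple1;
          sub (triple_mul e2 t) triple1; triple_add y triple1; sub z y; sub opp1 z]]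
  else false.

Variable F : finFieldType.
Variable r : F.
Let ofN (n : N) : F := (N.to_nat n)%:R.
Definition triple_eval (x : triple) : F :=
  let '(a, b, c) := x in ofN a + ofN b * r + ofN c * r ^+ 2.
Hypothesis p0 : ofN p = 0.
Hypothesis rg : r ^+ 3 = ofN g.
Hypothesis p_neq0 : p != 0%bin.

Lemma ofND m n : ofN (addN m n) = ofN m + ofN n.
Proof. by rewrite /ofN Nnat.N2Nat.inj_add plusE natrD. Qed.

Lemma ofNM m n : ofN (mulN m n) = ofN m * ofN n.
Proof. by rewrite /ofN Nnat.N2Nat.inj_mul multE natrM. Qed.

Lemma ofN_mod n : ofN (n %%% p) = ofN n.
Proof. by rewrite [in RHS](N.div_mod' n p) ofND ofNM p0 mul0r add0r. Qed.

Lemma ofN_pred : ofN (N.pred p) = -1.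
Proof.
apply/eqP; rewrite -subr_eq0 opprK -[1]/(ofN 1) -ofND N.add_1_r.
by rewrite N.succ_pred ?p0 //; apply/eqP.
Qed.

Lemma triple_evalD x y : triple_eval (triple_add x y) = triple_eval x + triple_eval y.
Proof.
by case: x y => [[a b] c] [[a' b'] c']; rewrite /triple_eval /= !ofN_mod !ofND; ring.
Qed.

Lemma triple_evalN x : triple_eval (triple_opp x) = - triple_eval x.
Proof.
by case: x => [[a b] c]; rewrite /triple_eval /= !ofN_mod !ofNM ofN_pred; ring.
Qed.

Lemma triple_evalM x y : triple_eval (triple_mul x y) = triple_eval x * triple_eval y.
Proof.
case: x y => [[a b] c] [[a' b'] c']; rewrite /triple_eval /= !ofN_mod !(ofND, ofNM) -rg.
ring.
Qed.

Lemma triple_evalX x n : triple_eval (triple_pow x n) = triple_eval x ^+ BinPos.Pos.to_nat n.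
Proof.
elim: n => [n IHn|n IHn|] //=; rewrite !triple_evalM IHn -exprD -?exprS; congr (_ ^+ _); lia.
Qed.

Lemma triple_eval1 : triple_eval triple1 = 1.
Proof. by rewrite /triple_eval /triple1 /ofN /= !mul0r !addr0. Qed.

Local Arguments triple_eval : simpl never.
Local Arguments triple_opp : simpl never.
Local Arguments triple_add : simpl never.
Local Arguments triple_mul : simpl never.

Lemma triple_starterP q e t y z : (#|F| = 19 %[mod 36])%N ->
  #|F| = N.to_nat q -> triple_starter q e t y z ->
  starter (triple_eval e) (triple_eval t) (triple_eval y) (triple_eval z).
Proof.
move=> F_mod Fq; rewrite /triple_starter; case: N.div => // k.
case/and4P=> /eqP Dq /eqP e0 c1 c2.
have kE : BinPos.Pos.to_nat k = class_exp F.
  have := card_class_exp F_mod; rewrite Fq Dq; lia.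
have E0 : triple_eval e * triple_eval e + triple_eval e + 1 = 0.
  rewrite -triple_evalM -triple_evalD -triple_eval1 -triple_evalD e0.
  by rewrite /triple_eval /ofN /= !mul0r !addr0.
(* If e^2 = 1 then e = e^3 = 1, whence 3 = e^2 + e + 1 = 0. *)
have e1 : triple_eval e ^+ 2 != 1.
  have := three_neq0 F_mod; apply: contra => /eqP E.
  have e_1 : triple_eval e = 1.
    apply: subr0_eq; rewrite -(mulr0 (triple_eval e - 1)) -E0.
    by rewrite -[X in X - 1]mulr1 -{1}E; ring.
  by apply/eqP; rewrite -E0 e_1; ring.
have e6 : triple_eval e ^+ 6 = 1.
  have -> : triple_eval e ^+ 6 = (triple_eval e ^+ 3 + 1) * (triple_eval e - 1)
    * (triple_eval e * triple_eval e + triple_eval e + 1) + 1 by ring.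
  by rewrite E0 mulr0 add0r.
have := uniq_signed_triple F_mod (w := triple_eval e * triple_eval e) e6 e1.
rewrite -expr2 -exprM => /(_ erefl) U.
set roots := [:: triple1; e; triple_mul e e; _; _; _] in c1 c2.
have rootsU : uniq (0 :: map triple_eval roots).
  rewrite [map _ _]/= !triple_evalN !triple_evalM triple_eval1 -expr2.
  exact: U.
have completeP s : let hs := [seq triple_pow x k | x <- s] in uniq hs && all [in roots] hs ->
    uniq (0 :: [seq triple_eval x ^+ class_exp F | x <- s]).
  move=> /= /andP[us /allP sr].
  have /andP[r0 rU] : (0 \notin map triple_eval roots)
    && uniq (map triple_eval roots) := rootsU.
  have -> : [seq triple_eval x ^+ class_exp F | x <- s]
      = map triple_eval [seq triple_pow x k | x <- s].
    by rewrite -map_comp; apply: eq_map => x /=; rewrite triple_evalX kE.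
  apply/andP; split.
    by apply: contra r0 => /mapP[x /sr xr ->]; apply: map_f.
  rewrite map_inj_in_uniq // => x x' /sr xr /sr xr'.
  by apply: (map_uniq_inj rU).
split=> //.
  have := completeP _ c1; rewrite /= !triple_evalN triple_eval1.
  by [].
have := completeP _ c2.
by rewrite /= !triple_evalD !triple_evalN !triple_evalM !triple_eval1.
Qed.
End TripleArithmetic.

Definition embed (a : N) : triple := (a, 0, 0)%bin.

(* Rows (p, e, t, y, z), found by computer search. *)
Definition prime_starters : seq (N * N * N * N * N) :=
  [:: (19, 7, 2, 5, 10); (127, 19, 3, 35, 21); (163, 58, 3, 4, 10);
  (199, 92, 2, 22, 31); (271, 28, 4, 15, 11); (307, 17, 7, 50, 45);
  (379, 51, 2, 19, 22); (487, 232, 2, 3, 17); (523, 60, 7, 21, 2);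
  (631, 43, 2, 11, 4); (739, 320, 3, 14, 18); (811, 130, 3, 24, 10);
  (883, 337, 6, 23, 3); (919, 52, 15, 20, 19); (991, 113, 2, 6, 39);
  (1063, 343, 6, 19, 26); (1171, 420, 2, 16, 18); (1279, 504, 2, 31, 9);
  (1423, 643, 6, 21, 9); (1459, 339, 3, 62, 18); (1531, 646, 2, 11, 37);
  (1567, 535, 4, 6, 2); (1747, 371, 3, 14, 20); (1783, 193, 5, 15, 13);
  (1999, 808, 3, 23, 30); (2143, 349, 5, 33, 38); (2179, 123, 5, 55, 50);
  (2251, 708, 5, 47, 42); (2287, 804, 13, 65, 19); (2467, 216, 3, 13, 4);
  (2503, 1226, 3, 25, 4); (2539, 306, 2, 16, 25); (2647, 185, 2, 37, 30);
  (2683, 636, 2, 16, 22); (2719, 1265, 2, 12, 14); (2791, 91, 3, 69, 18);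
  (2971, 54, 5, 74, 33); (3079, 546, 4, 33, 6); (3187, 1315, 2, 6, 19);
  (3259, 852, 3, 33, 20); (3331, 1463, 7, 46, 12); (3511, 756, 7, 16, 23);
  (3547, 1162, 2, 23, 21); (3583, 1038, 4, 13, 14); (3691, 474, 2, 20, 4);
  (3727, 1188, 2, 10, 19); (3907, 62, 5, 16, 25); (3943, 1135, 3, 50, 49);
  (4051, 797, 5, 12, 17); (4159, 1604, 2, 24, 22); (4231, 620, 2, 21, 6);
  (4339, 237, 11, 43, 68); (4447, 115, 2, 38, 45); (4483, 505, 2, 26, 4);
  (4519, 1056, 3, 46, 14); (4591, 310, 3, 29, 33); (4663, 2092, 3, 23, 43);
  (4951, 2261, 4, 61, 16); (4987, 1136, 3, 7, 16); (5023, 953, 2, 26, 4);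
  (5059, 1912, 2, 11, 28); (5167, 124, 5, 47, 18); (5347, 479, 3, 58, 17);
  (5419, 127, 5, 10, 23); (5527, 876, 2, 11, 10); (5563, 711, 2, 54, 10);
  (5743, 200, 4, 20, 33); (5779, 2851, 2, 49, 56); (5851, 577, 4, 33, 6);
  (5923, 428, 2, 29, 37); (6067, 665, 4, 12, 16); (6211, 136, 2, 6, 12);
  (6247, 2316, 4, 31, 48); (6427, 1084, 3, 17, 18); (6571, 2979, 4, 3, 13);
  (6607, 1518, 4, 6, 2); (6679, 942, 3, 20, 25); (6823, 2685, 2, 13, 3);
  (6967, 382, 10, 26, 33); (7039, 302, 2, 56, 52); (7219, 2725, 2, 16, 20);
  (7507, 606, 2, 22, 20); (7687, 2274, 2, 5, 4); (7723, 917, 12, 6, 18);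
  (7759, 1759, 2, 19, 18); (7867, 1465, 3, 6, 29); (8011, 89, 7, 56, 19);
  (8191, 90, 11, 57, 21); (8263, 240, 2, 42, 47); (8443, 1035, 2, 16, 20);
  (8623, 1545, 3, 17, 9); (8731, 3658, 2, 11, 20); (8803, 988, 2, 6, 49);
  (8839, 4372, 5, 42, 4); (9091, 3388, 2, 37, 40); (9127, 3010, 5, 26, 20);
  (9199, 3767, 3, 21, 2); (9343, 3230, 2, 17, 10); (9631, 1621, 5, 21, 30);
  (9739, 2768, 3, 20, 13); (9811, 602, 3, 17, 5); (9883, 2536, 3, 16, 7);
  (10099, 3947, 2, 17, 22); (10243, 563, 13, 67, 28);
  (10459, 1329, 5, 18, 25); (10531, 5080, 5, 21, 36);
  (10567, 1185, 2, 48, 17); (10639, 1893, 4, 17, 18);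
  (10711, 4500, 2, 47, 50); (10891, 1099, 5, 39, 47);
  (11071, 1738, 3, 20, 4); (11251, 1076, 2, 14, 4); (11287, 4197, 3, 81, 67);
  (11467, 3401, 2, 55, 34); (11503, 467, 2, 28, 9); (11719, 187, 5, 23, 31);
  (11827, 3740, 5, 6, 35); (11863, 3225, 3, 53, 29);
  (11971, 5225, 5, 60, 38); (12007, 1810, 11, 37, 130);
  (12043, 3163, 2, 22, 5); (12511, 3394, 2, 30, 5); (12547, 6217, 3, 7, 44);
  (12583, 1697, 5, 60, 50); (12619, 3774, 2, 16, 14);
  (12763, 3033, 2, 13, 3); (12799, 2418, 7, 42, 23);
  (12907, 2938, 3, 24, 40); (12979, 3841, 2, 5, 4); (13159, 303, 3, 5, 16);
  (13267, 199, 3, 35, 29); (13339, 3911, 2, 44, 20); (13411, 1975, 3, 5, 10);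
  (13591, 2741, 5, 12, 15); (13627, 3224, 4, 29, 38);
  (13807, 117, 2, 34, 30); (13879, 2878, 2, 6, 12); (14347, 4470, 3, 24, 7);
  (14419, 6630, 3, 4, 7); (14563, 4295, 3, 15, 37); (14779, 6688, 6, 17, 25);
  (14851, 2834, 2, 24, 5); (14887, 7382, 2, 26, 31); (14923, 4233, 4, 32, 2);
  (15031, 5359, 2, 23, 10); (15139, 5650, 3, 16, 4); (15319, 539, 3, 5, 15);
  (15391, 2964, 2, 6, 17); (15427, 3236, 4, 12, 2); (15607, 3187, 2, 5, 10);
  (15643, 4922, 5, 10, 22); (15679, 2960, 13, 39, 68);
  (15787, 4528, 2, 46, 11); (15823, 6716, 2, 26, 32);
  (15859, 2515, 2, 16, 10); (16111, 5666, 5, 56, 19);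
  (16183, 5209, 3, 19, 11); (16363, 5899, 2, 14, 13);
  (16651, 223, 3, 24, 45); (16759, 5700, 12, 2, 21);
  (16831, 1884, 2, 15, 19); (16903, 8386, 2, 20, 59);
  (17011, 6641, 3, 23, 31); (17047, 6097, 2, 12, 3);
  (17191, 1821, 3, 10, 25); (17299, 5722, 3, 24, 23);
  (17443, 6122, 3, 4, 14); (17551, 5733, 6, 22, 18);
  (17623, 3350, 2, 24, 34); (17659, 7887, 3, 22, 9);
  (17839, 5290, 6, 16, 23); (17911, 5048, 2, 11, 32);
  (18127, 7749, 9, 17, 14); (18199, 1018, 7, 37, 20);
  (18307, 5376, 11, 73, 117); (18379, 7324, 3, 14, 9);
  (18451, 8374, 3, 23, 9); (18523, 3064, 3, 25, 20); (18919, 2035, 3, 19, 2);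
  (19207, 7415, 3, 4, 54); (19387, 3147, 4, 17, 21);
  (19423, 9039, 4, 24, 23); (19531, 4124, 14, 28, 49);
  (19603, 9731, 4, 5, 30); (19819, 8962, 3, 39, 11); (19891, 1626, 2, 24, 4);
  (19927, 244, 2, 10, 41); (19963, 6345, 3, 4, 2); (20071, 4785, 2, 15, 4);
  (20107, 6965, 2, 6, 11); (20143, 375, 5, 30, 19); (20287, 7508, 2, 6, 5);
  (20323, 9904, 2, 15, 18); (20359, 6660, 7, 34, 19);
  (20431, 8791, 2, 17, 4); (20611, 4093, 3, 26, 9); (20719, 3176, 3, 37, 59);
  (20899, 8388, 2, 5, 4); (21187, 5069, 2, 22, 4); (21727, 7456, 3, 25, 13);
  (21799, 4978, 7, 62, 13); (21871, 10163, 2, 31, 49);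
  (21943, 9367, 2, 20, 36); (22051, 1564, 2, 16, 35);
  (22123, 8770, 11, 19, 13); (22159, 3519, 2, 13, 37);
  (22303, 831, 2, 19, 7); (22447, 259, 2, 12, 28); (22483, 10518, 4, 5, 6);
  (22699, 10281, 2, 19, 37); (22807, 7995, 6, 49, 55);
  (23059, 10936, 3, 51, 14); (23131, 3880, 3, 25, 28);
  (23167, 697, 4, 40, 9); (23203, 5901, 9, 5, 22); (23311, 9457, 2, 24, 7);
  (23563, 153, 2, 6, 22); (23599, 6764, 6, 13, 11); (23671, 8927, 3, 10, 36);
  (23743, 3931, 3, 37, 29); (23887, 3289, 3, 34, 9)]%bin.

Definition prime_row (row : N * N * N * N * N) : bool :=
  let '(p, e, t, y, z) := row in
  triple_starter p 0 p (embed e) (embed t) (embed y) (embed z).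

Lemma prime_rowsP : all prime_row prime_starters.
Proof. by vm_compute. Qed.

(** Both rows use r^3 = 2; the cube roots of unity are 2 modulo 7 and 7 modulo 19. *)
Lemma cube_rowsP :
  triple_starter 7 2 343 (2, 0, 0)%bin (1, 0, 1)%bin (0, 3, 1)%bin (3, 0, 1)%bin
  && triple_starter 19 2 6859 (7, 0, 0)%bin (0, 1, 1)%bin (0, 0, 8)%bin (3, 2, 0)%bin.
Proof. by vm_compute. Qed.

(** Orders congruent to 19 modulo 36 are prime to 6, and those tested are below 155^2, so prime
    divisors up to 151 suffice. The proper prime powers serve orders where a lower power is not
    coprime to its cofactor. *)
Definition small_divisors : seq N :=
  [:: 5; 7; 11; 13; 17; 19; 23; 25; 29; 31; 37; 41; 43; 47; 49; 53; 59; 61; 67; 71;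
  73; 79; 83; 89; 97; 101; 103; 107; 109; 113; 121; 125; 127; 131; 137; 139; 149; 151]%bin.

Definition coprime_divisor (q d : N) : bool :=
  let d' := N.div q d in
  [&& q == N.mul d d', N.gcd d d' == 1%bin & N.ltb 1 d'].

(* An order with a divisor coprime to its cofactor is not that of a field. *)
Definition small_order_test (q : N) : bool :=
  [|| q == 343%bin, q == 6859%bin, has (fun row => row.1.1.1.1 == q) prime_starters
    | has (coprime_divisor q) small_divisors].

(** For k = 6m + 3 the condition k < 4000 means m <= 666. *)
Lemma small_orders :
  all (fun m => small_order_test (N.add (N.mul 36 (N.of_nat m)) 19)) (iota 0 667).
Proof. by vm_compute. Qed.

(** * Fields with k below 4000 *)

Section SmallFields.
Variable F : finFieldType.
Hypothesis F_mod : (#|F| = 19 %[mod 36])%N.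
Local Notation k := (class_exp F).

Lemma natr_card : #|F|%:R = 0 :> F.
Proof. by rewrite -cardsT -FinRing.Theory.zmodXgE expg_cardG ?inE. Qed.

Lemma card_field_coprime a b : #|F| = (a * b)%N -> coprime a b -> (1 < a)%N -> (1 < b)%N -> False.
Proof.
have [p p_pr pF] := finPcharP F; have Fp := card_pprimeChar pF.
move=> Fab co a1 b1.
have dvp d : (1 < d)%N -> (d %| #|F|)%N -> (p %| d)%N.
  move=> d1; rewrite Fp => /(dvdn_pfactor _ _ p_pr)[[|n] _ Ed]; last first.
    by rewrite Ed expnS dvdn_mulr.
  by rewrite Ed in d1.
have pa : (p %| a)%N by rewrite dvp // Fab dvdn_mulr.
have pb : (p %| b)%N by rewrite dvp // Fab dvdn_mull.
have := dvdn_gcd p a b; rewrite (eqP co) pa pb.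
by rewrite dvdn1 gtn_eqF ?prime_gt1.
Qed.

(** Cubing is at most three-to-one on 6k nonzero elements, so there are at least 2k cubes; all are
    roots of X^(2k) - 1, which has at most 2k. *)
Lemma cube_root_exists (x : F) : x ^+ (2 * k) = 1 -> exists r, r ^+ 3 = x.
Proof.
pose I := [set y ^+ 3 | y in [set: F] :\ 0] => x1.
have k0 := class_exp_gt0 F_mod.
have sub : I \subset [set y : F | y ^+ (2 * k) == 1].
  apply/subsetP=> _ /imsetP[y y0 ->]; rewrite inE -exprM mulnA.
  by rewrite mulnC exprM (expr_class_exp6 F_mod) //; move: y0; rewrite !inE andbT.
have cardI : (2 * k <= #|I|)%N.
  have : (6 * k <= \sum_(y in I) 3)%N.
    have <- : #|[set: F] :\ 0| = (6 * k)%N.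
      by have := cardsD1 (0 : F) [set: F]; rewrite in_setT cardsT (card_class_exp F_mod) add1n => -[->].
    rewrite -sum1_card (partition_big (fun y => y ^+ 3) [in I]) /=; last first.
      by move=> y yF; apply: imset_f.
    apply: leq_sum => y _; apply: leq_trans (card_expr_le y (isT : 0 < 3)%N).
    rewrite sum1_card; apply: subset_leq_card; apply/subsetP=> z.
    by rewrite !inE => /andP[].
  rewrite sum_nat_const; lia.
have : x \in I.
  have /eqP -> : I == [set y : F | y ^+ (2 * k) == 1].
    rewrite eqEcard sub (leq_trans _ cardI) //; apply: card_expr_le; lia.
  by rewrite inE x1.
by case/imsetP=> r _ ->; exists r.
Qed.

(** The triples need a cube root of 2, which exists because 2^n = 1 for a divisor n of 2k. *)
Lemma starter_cube p n q e t y z : #|F| = N.to_nat q ->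
  N.to_nat q = (N.to_nat p ^ 3)%N -> p != 0%bin -> (n %| 2 * k)%N ->
  ((N.to_nat p)%:R = 0 :> F -> (2 : F) ^+ n = 1) ->
  triple_starter p 2 q e t y z -> exists e t y z : F, starter e t y z.
Proof.
move=> Fq qp p0 /dvdnP[m nk].
have pF : (N.to_nat p)%:R = 0 :> F.
  by apply/eqP; have /eqP := natr_card; rewrite Fq qp natrX expf_eq0.
move=> /(_ pF) two_n.
have [|r r3] := @cube_root_exists 2; first by rewrite nk mulnC exprM two_n expr1n.
move/(triple_starterP pF (r3 : _ = (N.to_nat 2)%:R) p0 F_mod Fq) => st.
by eexists _, _, _, _; apply: st.
Qed.

Lemma starter_small : (k < 4000)%N -> exists e t y z : F, starter e t y z.
Proof.
have [m km] := class_expE F_mod; move=> k_small.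
have Fm : #|F| = (36 * m + 19)%N by rewrite (card_class_exp F_mod) km; lia.
have m_small : (m < 667)%N by lia.
have : small_order_test (N.add (N.mul 36 (N.of_nat m)) 19).
  by apply: (allP small_orders m); rewrite mem_iota.
set q := N.add _ _; have Fq : #|F| = N.to_nat q.
  by rewrite /q Nnat.N2Nat.inj_add Nnat.N2Nat.inj_mul Nnat.Nat2N.id Fm.
have /andP[st7 st19] := cube_rowsP.
case/or4P=> [/eqP Eq|/eqP Eq|/hasP[row row_in /eqP Eq]|/hasP[d d_in]].
- have {}Fq : #|F| = N.to_nat 343 by rewrite Fq Eq.
  have k57 : k = 57%N by have := card_class_exp F_mod; rewrite Fq; lia.
  have two3 : (N.to_nat 7)%:R = 0 :> F -> (2 : F) ^+ 3 = 1.
    move=> seven; have -> : (2 : F) ^+ 3 = 7 + 1 by ring.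
    by rewrite [7]seven add0r.
  have dv : (3 %| 2 * k)%N by rewrite k57.
  exact: (@starter_cube 7 3 343 _ _ _ _ Fq erefl isT dv two3 st7).
- have {}Fq : #|F| = N.to_nat 6859 by rewrite Fq Eq.
  have k1143 : k = 1143%N by have := card_class_exp F_mod; rewrite Fq; lia.
  have two18 : (N.to_nat 19)%:R = 0 :> F -> (2 : F) ^+ 18 = 1.
    (* Here 2^9 = 512 = 27 * 19 - 1. *)
    move=> nineteen; have -> : (2 : F) ^+ 18 = (27 * 19 - 1) ^+ 2 by ring.
    by rewrite [19]nineteen mulr0 sub0r sqrrN expr1n.
  have dv : (18 %| 2 * k)%N by rewrite k1143.
  exact: (@starter_cube 19 18 6859 _ _ _ _ Fq erefl isT dv two18 st19).
- have := allP prime_rowsP _ row_in; move: row Eq row_in => [[[[p e] t] y] z] /= -> _ st.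
  have q0 : q != 0%bin by apply: contra_eq_neq Fq => ->; rewrite -lt0n (card_class_exp F_mod).
  have pF : (N.to_nat q)%:R = 0 :> F by rewrite -Fq natr_card.
  (* Prime fields need no adjoined root, so r = 0 and g = 0. *)
  have r0 : (0 : F) ^+ 3 = (N.to_nat 0)%:R by rewrite expr0n.
  have X := triple_starterP pF r0 q0 F_mod Fq st.
  by eexists _, _, _, _; apply: X.
case/and3P=> /eqP Eq /eqP co gt1; exfalso.
apply: (@card_field_coprime (N.to_nat d) (N.to_nat (N.div q d))).
- by rewrite Fq {1}Eq Nnat.N2Nat.inj_mul.
- rewrite /coprime -dvdn1; set c := gcdn _ _.
  have dvc n : (c %| N.to_nat n)%N -> N.divide (N.of_nat c) n.
    case/dvdnP=> m' nE; exists (N.of_nat m').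
    by rewrite -Nnat.Nat2N.inj_mul multE -nE Nnat.N2Nat.id.
  have := N.gcd_greatest _ _ _ (dvc _ (dvdn_gcdl _ _)) (dvc _ (dvdn_gcdr _ _)).
  rewrite co => -[m' m'c]; apply/dvdnP; exists (N.to_nat m').
  by have := congr1 N.to_nat m'c; rewrite Nnat.N2Nat.inj_mul Nnat.Nat2N.id.
- by move: d d_in {Eq co gt1}; apply/allP.
by move/N.ltb_lt: gt1; lia.
Qed.

End SmallFields.

(* Components of v and the order of the product ring *)
Local Close Scope ring_scope.

Lemma starter_exists (F : finFieldType) : #|F| = 19 %[mod 36] ->
  exists e t y z : F, starter e t y z.
Proof.
move=> F_mod; have [k_large|k_small] := leqP 4000 (class_exp F).
  exact: starter_large.
exact: starter_small.
Qed.

Lemma components_uniq v : uniq (components v).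
Proof.
rewrite map_inj_in_uniq ?primes_uniq // => p l pv lv E.
have [p_pr l_pr] : prime p /\ prime l.
  by move: pv lv; rewrite !mem_primes => /and3P[-> _ _] /and3P[-> _ _].
have: p %| v`_l by rewrite -E p_part dvdn_exp // logn_gt0.
by rewrite p_part Euclid_dvdX // dvdn_prime2 // => /andP[/eqP].
Qed.

Lemma prod_components v : 0 < v -> \prod_(q <- components v) q = v.
Proof.
move=> v0; rewrite [RHS]prod_prime_decomp // prime_decompE !big_map.
by apply: eq_bigr => p _; rewrite p_part.
Qed.

Lemma card_FF v : 0 < v -> #|{: FF v}| = v.
Proof.
move=> v0; rewrite card_dep_ffun /image_mem (eq_map (@card_component_field v)) foldrE big_map.
rewrite -[RHS]prod_components // -(big_map (@ssval _ _) xpredT id); apply: perm_big.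
apply: uniq_perm; [|exact: components_uniq|].
  by rewrite (map_inj_uniq val_inj) -?enumT enum_uniq.
move=> q; apply/mapP/idP=> [[x _ ->]|qv]; first exact: ssvalP.
by exists (SeqSub qv); rewrite -?enumT ?mem_enum.
Qed.

Theorem theorem8p2 (v : nat) (v_gt1 : 1 < v)
    (v_components : forall q : nat, q \in components v -> q = 19 %[mod 36]) :
  exists B : {set {set ('Z_3 * FF v)%type}},
    linear_space [:: 3; 6] (3 * v) B /\ harmonious B.
Proof.
have F_mod (q : seq_sub (components v)) : #|component_field q| = 19 %[mod 36].
  by rewrite card_component_field v_components ?ssvalP.
have v0 : 0 < v := ltnW v_gt1.
(* As v > 1, its smallest prime divisor provides the index required for the product. *)
have pv : v`_(pdiv v) \in components v.
  by apply: map_f; rewrite mem_primes pdiv_prime // v0 pdiv_dvd.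
have := prod_ring_harmonious F_mod (SeqSub pv) (fun q => starter_exists (F_mod q)).
by rewrite (card_FF v0).
Qed.
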